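(* Let $R\subset S$ be an infra-integral FCP extension of rings. The following conditions are equivalent: (1) $R\subset S$ is a $\Delta$-extension; (2) $R\subset S$ is modular; (3) $\ell[T\cap U,T]+\ell[T\cap U,U]=\ell[T\cap U,TU]$ for all $T,U\in[R,S]$; (4) $R\subset S$ is semimodular; (5) $\ell[T,UV]=2$ for all $T,U,V\in[R,S]$ such that $T\subset U$ and $T\subset V$ are minimal with $U\neq V$.
   Context: All rings are commutative and unital. For a ring extension $R\subseteq S$, $[R,S]$ denotes the set of all $R$-subalgebras of $S$, ordered by inclusion; it is a lattice with infimum the intersection and supremum the compositum (product) $TU$. The extension is FCP if every chain in $[R,S]$ is finite; the length $\ell[R,S]$ is the supremum of the lengths of chains in $[R,S]$ (a chain with $n+1$ elements having length $n$). It is a $\Delta$-extension if $T+U\in[R,S]$ for all $T,U\in[R,S]$ (equivalently $T+U=TU$). It is minimal if $[R,S]=\{R,S\}$ and $R\ne S$. It is infra-integral if it is integral and for each $Q\in\mathrm{Spec}(S)$, with $P:=Q\cap R$, the residual field extension $\kappa_R(P)\to\kappa_S(Q)$ is an isomorphism. It is modular if $T_1\cap(T_2T_3)=T_2(T_1\cap T_3)$ for all $T_1,T_2,T_3\in[R,S]$ with $T_2\subseteq T_1$. It is semimodular if for all $T_1,T_2\in[R,S]$ such that $T_1\cap T_2\subset T_i$ is minimal for $i=1,2$, the extension $T_i\subset T_1T_2$ is minimal for $i=1,2$. *)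

(* Defs.v *)
From HB Require Import structures.
From mathcomp Require Import all_boot all_order all_algebra.
From mathcomp Require Import generic_quotient ring_quotient.
From mathcomp Require Import boolp classical_sets functions cardinality.
From mathcomp Require Import constructive_ereal.

Set Implicit Arguments.
Unset Strict Implicit.
Unset Printing Implicit Defensive.

Import Order.TTheory GRing.Theory Num.Theory.

Local Open Scope classical_set_scope.
Local Open Scope card_scope.
Local Open Scope quotient_scope.
Local Open Scope ring_scope.

(* The quotient of a commutative ring by a prime ideal, as an integral domain;
   units and inverses, which [idomainType] requires, are chosen classically. *)
Section QuotientDomain.
Variables (A : comNzRingType) (I : prime_idealr A).

Definition quot_domain : Type := {ideal_quot I}.

HB.instance Definition _ := GRing.ComNzRing.on quot_domain.
HB.instance Definition _ := generic_quotient.Quotient.on quot_domain.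

Definition quot_unit (x : quot_domain) : bool := `[< exists y, y * x = 1 >].

Definition quot_inv (x : quot_domain) : quot_domain :=
  if pselect (exists y, y * x = 1) is left ex then projT1 (cid ex) else x.

Lemma quot_mulVx : {in quot_unit, left_inverse 1 quot_inv *%R}.
Proof.
move=> x /asboolP xu; rewrite /quot_inv.
by case: pselect => // ex; case: (cid ex).
Qed.

Lemma quot_unitPl (x y : quot_domain) : y * x = 1 -> quot_unit x.
Proof. by move=> yx1; apply/asboolP; exists y. Qed.

Lemma quot_inv_out : {in [predC quot_unit], quot_inv =1 id}.
Proof.
move=> x; rewrite inE /= => /asboolPn xu; rewrite /quot_inv.
by case: pselect.
Qed.

HB.instance Definition _ := GRing.ComNzRing_hasMulInverse.Build quot_domain
  quot_mulVx quot_unitPl quot_inv_out.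
HB.instance Definition _ := GRing.ComUnitRing_isIntegral.Build quot_domain
  (@Quotient.rquot_IdomainAxiom A I).

Definition quot_proj (x : A) : quot_domain := \pi x.

Lemma quot_proj_is_zmod_morphism : zmod_morphism quot_proj.
Proof. exact: (rmorphB \pi_({ideal_quot I})). Qed.

Lemma quot_proj_is_monoid_morphism : monoid_morphism quot_proj.
Proof.
by split; [exact: (rmorph1 \pi_({ideal_quot I})) |
           exact: (rmorphM \pi_({ideal_quot I}))].
Qed.

HB.instance Definition _ := GRing.isZmodMorphism.Build A quot_domain quot_proj
  quot_proj_is_zmod_morphism.
HB.instance Definition _ := GRing.isMonoidMorphism.Build A quot_domain quot_proj
  quot_proj_is_monoid_morphism.

Lemma quot_proj_eq0 x : (quot_proj x == 0) = (x \in I).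
Proof.
by rewrite -(rmorph0 quot_proj) /quot_proj -Quotient.idealrBE ?subr0.
Qed.

Lemma quot_proj_surj (x : quot_domain) : exists a, x = quot_proj a.
Proof. by exists (repr x); rewrite /quot_proj reprK. Qed.

Definition residue_field : fieldType := {fraction quot_domain}.

End QuotientDomain.

Local Notation "x %:F" := (FracField.tofrac x) (at level 1).

Lemma frac_ratio (D : idomainType) (x : {fraction D}) :
  x = (\n_(repr x))%:F / (\d_(repr x))%:F.
Proof.
have d0 := denom_ratioP (repr x).
apply: (mulIf (x := (\d_(repr x))%:F)); first by rewrite tofrac_eq0.
rewrite divfK ?tofrac_eq0 // -{1}[x]reprK /FracField.tofrac; unlock.
rewrite -[LHS]FracField.pi_mul; apply/eqmodP.
by rewrite /= FracField.equivfE /FracField.mulf !numden_Ratio ?mulr1 ?oner_eq0 //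
  mulrC.
Qed.

Section ResidualExtension.
Variables (A B : comNzRingType) (f : {rmorphism A -> B}) (Q : prime_idealr B).

Definition preim_pred (x : A) : bool := f x \in Q.

Lemma preim_pred_idealr : idealr_closed preim_pred.
Proof.
split=> [||a x y]; rewrite -!topredE /= /preim_pred.
- by rewrite rmorph0 rpred0.
- by rewrite rmorph1 idealr1.
- by move=> fx fy; rewrite rmorphD rmorphM rpredD // idealMr.
Qed.

Lemma preim_pred_prime : prime_idealr_closed preim_pred.
Proof.
by move=> x y; rewrite -!topredE /= /preim_pred rmorphM prime_idealrM.
Qed.

HB.instance Definition _ := isIdealr.Build A preim_pred preim_pred_idealr.
HB.instance Definition _ :=
  isPrimeIdealrClosed.Build A preim_pred preim_pred_prime.

Definition contraction : prime_idealr A := PrimeIdealr.clone A preim_pred _.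

Lemma in_contraction x : (x \in contraction) = (f x \in Q).
Proof. by []. Qed.

(* The ring morphism A / f^-1(Q) -> B / Q induced by f. *)
Definition quot_map (x : quot_domain contraction) : quot_domain Q :=
  quot_proj Q (f (repr x)).

(* The residual extension Frac(A / f^-1(Q)) -> Frac(B / Q), a/b |-> f(a)/f(b). *)
Definition residual_map (x : residue_field contraction) : residue_field Q :=
  (quot_map \n_(repr x))%:F / (quot_map \d_(repr x))%:F.

Lemma quot_map_proj x : quot_map (quot_proj contraction x) = quot_proj Q (f x).
Proof.
apply/eqP; rewrite -subr_eq0 -rmorphB quot_proj_eq0 -rmorphB -in_contraction.
by rewrite -quot_proj_eq0 rmorphB subr_eq0 /= /quot_proj reprK.
Qed.

Lemma quot_map_is_zmod_morphism : zmod_morphism quot_map.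
Proof.
move=> x y; have [a ->] := quot_proj_surj x; have [b ->] := quot_proj_surj y.
by rewrite -rmorphB !quot_map_proj !rmorphB.
Qed.

Lemma quot_map_is_monoid_morphism : monoid_morphism quot_map.
Proof.
split=> [|x y]; first by rewrite -(rmorph1 (quot_proj _)) quot_map_proj !rmorph1.
have [a ->] := quot_proj_surj x; have [b ->] := quot_proj_surj y.
by rewrite -rmorphM !quot_map_proj !rmorphM.
Qed.

HB.instance Definition _ := GRing.isZmodMorphism.Build
  (quot_domain contraction) (quot_domain Q) quot_map quot_map_is_zmod_morphism.
HB.instance Definition _ := GRing.isMonoidMorphism.Build
  (quot_domain contraction) (quot_domain Q) quot_map quot_map_is_monoid_morphism.

Lemma quot_map_eq0 x : (quot_map x == 0) = (x == 0).
Proof.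
have [a ->] := quot_proj_surj x.
by rewrite quot_map_proj !quot_proj_eq0 in_contraction.
Qed.

Lemma residual_map_ratio a b : b != 0 ->
  residual_map (a%:F / b%:F) = (quot_map a)%:F / (quot_map b)%:F.
Proof.
move=> b0; rewrite /residual_map; set z := a%:F / b%:F.
have d0 := denom_ratioP (repr z).
apply/eqP; rewrite eqr_div ?tofrac_eq0 ?quot_map_eq0 // -!rmorphM tofrac_eq.
apply/eqP; congr quot_map; apply/eqP; rewrite -tofrac_eq !rmorphM /=.
by rewrite -eqr_div ?tofrac_eq0 // -frac_ratio.
Qed.

Lemma residual_map_is_zmod_morphism : zmod_morphism residual_map.
Proof.
move=> x y; rewrite [x]frac_ratio [y]frac_ratio.
have := denom_ratioP (repr x); have := denom_ratioP (repr y).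
move: \n_(repr x) \d_(repr x) \n_(repr y) \d_(repr y) => a b c d d0 b0.
have F0 (u : quot_domain contraction) : u != 0 -> u%:F != 0 by rewrite tofrac_eq0.
have G0 (u : quot_domain contraction) : u != 0 -> (quot_map u)%:F != 0.
  by rewrite tofrac_eq0 quot_map_eq0.
have -> : a%:F / b%:F - c%:F / d%:F = (a * d - c * b)%:F / (b * d)%:F.
  by rewrite -mulNr addf_div ?F0 // !(rmorphB, rmorphM) mulNr.
rewrite !residual_map_ratio ?mulf_neq0 // -[in RHS]mulNr addf_div ?G0 //.
by rewrite !(rmorphB, rmorphM) mulNr.
Qed.

Lemma residual_map_is_monoid_morphism : monoid_morphism residual_map.
Proof.
split=> [|x y].
  have {1}-> : 1 = 1%:F / 1%:F :> residue_field contraction.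
    by rewrite rmorph1 divr1.
  by rewrite residual_map_ratio ?oner_eq0 // !rmorph1 divr1.
rewrite [x]frac_ratio [y]frac_ratio.
have := denom_ratioP (repr x); have := denom_ratioP (repr y).
move: \n_(repr x) \d_(repr x) \n_(repr y) \d_(repr y) => a b c d d0 b0.
have -> : a%:F / b%:F * (c%:F / d%:F) = (a * c)%:F / (b * d)%:F.
  by rewrite mulf_div !rmorphM.
by rewrite !residual_map_ratio ?mulf_neq0 // mulf_div !rmorphM.
Qed.

HB.instance Definition _ := GRing.isZmodMorphism.Build
  (residue_field contraction) (residue_field Q) residual_map
  residual_map_is_zmod_morphism.
HB.instance Definition _ := GRing.isMonoidMorphism.Build
  (residue_field contraction) (residue_field Q) residual_map
  residual_map_is_monoid_morphism.

End ResidualExtension.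

Arguments contraction {A B} f Q.
Arguments quot_map {A B} f Q x.
Arguments residual_map {A B} f Q x.

Section SubringType.
Variables (S : comNzRingType) (R : subringClosed S).

Definition subring_type : Type := {x : S | x \in R}.

HB.instance Definition _ := SubChoice.on subring_type.
HB.instance Definition _ := [SubChoice_isSubComNzRing of subring_type by <:].

Definition subring_incl : {rmorphism subring_type -> S} :=
  (val : subring_type -> S).

End SubringType.

Section RingExtension.
Variable S : comNzRingType.
Implicit Types A B T U V : set S.

(* When A and B are subrings of S with A `<=` B, these are the A-subalgebras of
   B: a subset of S is an A-subalgebra iff it is a subring containing A. *)
Definition intermediate A B : set (set S) :=
  [set T | [/\ GRing.subring_closed (mem T), A `<=` T & T `<=` B]].

Definition is_chain (C : set (set S)) : Prop := total_on C subset.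

Definition fcp A B : Prop :=
  forall C, C `<=` intermediate A B -> is_chain C -> finite_set C.

(* Lengths of the finite chains in [A, B]; an infinite chain contains finite
   chains of every length, so it contributes nothing more to the supremum. *)
Definition chain_lengths A B : set nat :=
  [set n | exists C : set (set S),
    [/\ C `<=` intermediate A B, is_chain C & C #= `I_n.+1]].

(* The codomain is extended since the lengths of chains may be unbounded;
   [ext_length_supremum] below shows that the default value 0 of [supremum] is
   not used as soon as some chain exists. *)
Definition ext_length A B : \bar int :=
  supremum 0%E [set (Posz n)%:E | n in chain_lengths A B].

Lemma ext_length_supremum A B : chain_lengths A B !=set0 ->
  supremums [set (Posz n)%:E | n in chain_lengths A B] (ext_length A B).
Proof.
move=> [n0 n0P]; rewrite /ext_length /supremum.
set D := (X in supremums X).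
have D0 : D (Posz n0)%:E by exists n0.
case: ifP => [/eqP DE | _]; first by move: D0; rewrite /D DE.
apply: xgetPex.
have [/nat_supremums_neq0 [m [ubm lbm]] | nub] :=
  pselect (ubound (chain_lengths A B) !=set0).
  exists (Posz m)%:E; split=> [_ [n nP <-] | [z| |] ubz].
  - by rewrite lee_fin lez_nat; apply: ubm.
  - have := ubz _ D0; rewrite !lee_fin; case: z ubz => // k ubz _.
    rewrite lez_nat; apply: lbm => n nP.
    by have := ubz (Posz n)%:E (ex_intro2 _ _ n nP erefl); rewrite lee_fin lez_nat.
  - by rewrite leey.
  - by have := ubz _ D0.
exists +oo%E; split=> [_ [n nP <-] | [z| |] ubz].
- by rewrite leey.
- exfalso; apply: nub; have := ubz _ D0; rewrite lee_fin; case: z ubz => // k ubz _.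
  exists k => n nP.
  by have := ubz (Posz n)%:E (ex_intro2 _ _ n nP erefl); rewrite lee_fin lez_nat.
- by [].
- by have := ubz _ D0.
Qed.

Definition minimal_ext A B : Prop :=
  intermediate A B = [set A; B] /\ A <> B.

Definition setsum T U : set S := [set t + u | t in T & u in U].

(* The product TU: the finite sums of products tu. *)
Definition compositum T U : set S :=
  [set x | exists n (t u : 'I_n -> S),
    [/\ forall i, T (t i), forall i, U (u i) & x = \sum_(i < n) t i * u i]].

Lemma compositumE T U :
  GRing.subring_closed (mem T) -> GRing.subring_closed (mem U) ->
  compositum T U =
  smallest (fun V => GRing.subring_closed (mem V)) (T `|` U).
Proof.
move=> [T1 TB TM] [U1 UB UM].
have TUm t u : T t -> U u -> compositum T U (t * u).
  move=> Tt Uu; exists 1%N, (fun=> t), (fun=> u).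
  by split=> //; rewrite big_ord1.
apply/seteqP; split=> [x [n [t [u [Tt Uu ->]]]] V [[V1 VB VM] TUV] | x].
  have V0 : 0 \in mem V by rewrite -(subrr 1) VB.
  have VN y : y \in mem V -> - y \in mem V by move=> Vy; rewrite -sub0r VB.
  have VD y z : y \in mem V -> z \in mem V -> y + z \in mem V.
    by move=> Vy Vz; rewrite -(opprK z) VB ?VN.
  suff : \sum_(i < n) t i * u i \in mem V by rewrite inE.
  elim/big_ind: _ => // i _.
  by apply: VM; rewrite inE; apply: TUV; [left | right].
apply; split; last first.
  move=> y [Ty | Uy]; first by rewrite -(mulr1 y); apply: TUm => //; apply: set_mem.
  by rewrite -(mul1r y); apply: TUm => //; apply: set_mem.
have T0 : 0 \in mem T by rewrite -(subrr 1) TB.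
have TN y : T y -> T (- y).
  by move=> Ty; rewrite -sub0r; have := TB 0 y T0; rewrite !inE; apply.
have C0 : compositum T U 0.
  exists 0%N, (fun=> 0), (fun=> 0); split; [by case | by case |].
  by rewrite big_ord0.
have CD y z : compositum T U y -> compositum T U z -> compositum T U (y + z).
  move=> [m [t [u [Tt Uu ->]]]] [n [t' [u' [Tt' Uu' ->]]]].
  exists (m + n)%N,
    (fun i : 'I_(m + n) => match fintype.split i with inl j => t j | inr j => t' j end),
    (fun i : 'I_(m + n) => match fintype.split i with inl j => u j | inr j => u' j end).
  split=> [i | i |]; [by case: fintype.split | by case: fintype.split |].
  rewrite big_split_ord /=; congr (_ + _); apply: eq_bigr => i _.
    by case: fintype.splitP => j /= ij; [congr (t _ * u _); apply: val_inj |
      have := ltn_ord i; rewrite ij ltnNge leq_addr].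
  case: fintype.splitP => j /= ij.
    by have := ltn_ord j; rewrite -ij ltnNge leq_addr.
  by congr (t' _ * u' _); apply: val_inj; apply/eqP; rewrite -(eqn_add2l m) ij.
have CN y : compositum T U y -> compositum T U (- y).
  move=> [m [t [u [Tt Uu ->]]]]; exists m, (fun i => - t i), u.
  split=> // [i|]; first exact: TN.
  by rewrite -sumrN; apply: eq_bigr => i _; rewrite mulNr.
have Csum n (F : 'I_n -> S) :
    (forall i, compositum T U (F i)) -> compositum T U (\sum_(i < n) F i).
  by move=> CF; elim/big_ind: _.
split=> [|y z|y z]; rewrite !inE.
- by rewrite -(mulr1 1); apply: TUm; apply: set_mem.
- by move=> Cy Cz; apply: CD => //; apply: CN.
move=> [m [t [u [Tt Uu ->]]]] [n [t' [u' [Tt' Uu' ->]]]].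
rewrite mulr_suml; apply: (Csum) => i; rewrite mulr_sumr; apply: (Csum) => j.
rewrite mulrACA; apply: TUm.
  by have := TM (t i) (t' j); rewrite !inE; apply.
by have := UM (u i) (u' j); rewrite !inE; apply.
Qed.

Definition delta_ext A B : Prop :=
  forall T U, intermediate A B T -> intermediate A B U ->
    intermediate A B (setsum T U).

Definition modular_ext A B : Prop :=
  forall T1 T2 T3, intermediate A B T1 -> intermediate A B T2 ->
    intermediate A B T3 -> T2 `<=` T1 ->
    T1 `&` compositum T2 T3 = compositum T2 (T1 `&` T3).

Definition semimodular_ext A B : Prop :=
  forall T1 T2, intermediate A B T1 -> intermediate A B T2 ->
    minimal_ext (T1 `&` T2) T1 -> minimal_ext (T1 `&` T2) T2 ->
    minimal_ext T1 (compositum T1 T2) /\ minimal_ext T2 (compositum T1 T2).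

(* Residual extensions are taken along the inclusion R -> S, so the contraction
   of Q is the intersection of Q with R. *)
Definition infra_integral (R : subringClosed S) : Prop :=
  integralRange (subring_incl R) /\
  forall Q : prime_idealr S, bijective (residual_map (subring_incl R) Q).

End RingExtension.

(* Main.v *)
(* The implications (1) => (2) => (3) => (4) => (5) only use the lattice of
   intermediate rings.  For (5) => (1), the key fact is that when A < B is
   minimal in [R, S] and R < S is infra-integral, B = A + R x for every x in B
   outside A.  Let C = (A : B) be the conductor, a maximal ideal of A by
   Nakayama's lemma.  By lying over and the residual isomorphisms, no
   multiplicative set generated by elements s x - r of B, with r, s in R and s
   outside C, avoids C; this yields y outside C with y (x - r) in C for some r in
   R, so that y b is congruent modulo C to a multiple u y with u in R, for every b
   in B.  Hence A + R y is a ring, so it is B, and x may replace y.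
   Consequently, if W < T and W < U are minimal and U < TU is minimal, then
   TU = T + U; the general case follows by Noetherian induction on a ring W
   contained in T and U. *)
From HB Require Import structures.
From mathcomp Require Import all_boot all_order all_algebra.
From mathcomp Require Import fraction ring_quotient.
From mathcomp Require Import boolp classical_sets cardinality.
From mathcomp Require Import constructive_ereal.
Require Import Defs.

Set Implicit Arguments.
Unset Strict Implicit.
Unset Printing Implicit Defensive.

Import Order.TTheory GRing.Theory.

Local Open Scope classical_set_scope.
Local Open Scope ring_scope.

(** * Proper inclusion of sets *)

Section ProperSubsets.
Variable X : Type.
Implicit Types A B C : set X.

Lemma sub_neq_proper A B : A `<=` B -> A <> B -> A `<` B.
Proof. by move=> AB nAB; split=> // BA; apply: nAB; apply/seteqP. Qed.

Lemma proper_neq A B : A `<` B -> A <> B.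
Proof. by move=> [_ +] eAB; rewrite eAB; apply. Qed.

Lemma sub_proper_trans A B C : A `<=` B -> B `<` C -> A `<` C.
Proof.
move=> AB [BC CB]; split=> [|CA]; first exact: subset_trans BC.
by apply: CB; exact: subset_trans AB.
Qed.

Lemma proper_sub_trans A B C : A `<` B -> B `<=` C -> A `<` C.
Proof.
move=> [AB BA] BC; split=> [|CA]; first exact: subset_trans BC.
by apply: BA; exact: subset_trans CA.
Qed.

End ProperSubsets.

(** * Subrings, submodules and a form of Nakayama's lemma *)

Section SubringsAndSubmodules.
Variable S : comNzRingType.
Implicit Types (I M N T X : set S) (g : seq S).

Definition subring T := GRing.subring_closed (mem T).

Lemma subringE T :
  subring T <-> [/\ T 1, forall x y, T x -> T y -> T (x - y) &
                    forall x y, T x -> T y -> T (x * y)].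
Proof.
split=> [[T1 TB TM] | [T1 TB TM]]; split=> [|x y|x y]; rewrite ?inE //.
- by rewrite -inE.
- by have := TB x y; rewrite !inE.
- by have := TM x y; rewrite !inE.
- exact: TB.
- exact: TM.
Qed.

Lemma subring1 T : subring T -> T 1.
Proof. by case/subringE. Qed.

Lemma subringB T x y : subring T -> T x -> T y -> T (x - y).
Proof. by case/subringE => _ + _; apply. Qed.

Lemma subringM T x y : subring T -> T x -> T y -> T (x * y).
Proof. by case/subringE => _ _; apply. Qed.

Lemma subring0 T : subring T -> T 0.
Proof. by move=> rT; rewrite -(subrr 1); apply: subringB => //; exact: subring1. Qed.

Lemma subringN T x : subring T -> T x -> T (- x).
Proof. by move=> rT Tx; rewrite -sub0r; apply: subringB => //; exact: subring0. Qed.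

Lemma subringD T x y : subring T -> T x -> T y -> T (x + y).
Proof.
by move=> rT Tx Ty; rewrite -(opprK y); apply: subringB => //; exact: subringN.
Qed.

Lemma subringX T x n : subring T -> T x -> T (x ^+ n).
Proof.
move=> rT Tx; elim: n => [|n IHn]; first exact: subring1.
by rewrite exprS; apply: subringM.
Qed.

Definition addclosed N := N 0 /\ forall x y, N x -> N y -> N (x + y).

Definition submod T N := addclosed N /\ forall a x, T a -> N x -> N (a * x).

Lemma addclosed_sum N n (F : 'I_n -> S) :
  addclosed N -> (forall i, N (F i)) -> N (\sum_(i < n) F i).
Proof. by case=> N0 ND NF; elim/big_ind: _. Qed.

Lemma submodN T N x : subring T -> submod T N -> N x -> N (- x).
Proof.
move=> rT [_ NM] Nx; rewrite -mulN1r; apply: NM => //.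
by apply: subringN => //; exact: subring1.
Qed.

Lemma submodB T N x y : subring T -> submod T N -> N x -> N y -> N (x - y).
Proof.
by move=> rT mN Nx Ny; apply: (mN.1).2 => //; exact: submodN mN Ny.
Qed.

Lemma subring_submod T : subring T -> submod T T.
Proof.
move=> rT; split=> [|a x]; last exact: subringM.
by split=> [|x y]; [exact: subring0 | exact: subringD].
Qed.

Lemma submod_set0 T : submod T [set 0].
Proof.
split=> [|a x _ -> /=]; last by rewrite mulr0.
by split=> // x y -> -> /=; rewrite addr0.
Qed.

(* The set of all n + \sum_i a_i g_i with n in N and the a_i in I. *)
Fixpoint lspan I N g : set S :=
  if g is h :: g' then [set v | exists2 a, I a & lspan I N g' (v - a * h)] else N.

Lemma lspan_addclosed I N g :
  addclosed I -> addclosed N -> addclosed (lspan I N g).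
Proof.
move=> [I0 ID] cN; elim: g => //= h g [IH0 IHD].
split=> [|x y [a Ia xa] [b Ib yb]] /=.
  by exists 0; rewrite // mul0r subr0.
exists (a + b); first exact: ID.
by rewrite mulrDl opprD addrACA; apply: IHD.
Qed.

Lemma lspan_submod T I N g : submod T I -> submod T N -> submod T (lspan I N g).
Proof.
move=> [cI IM] [cN NM]; split; first exact: lspan_addclosed.
elim: g => [//|h g IH] a x Ta /= [b Ib xb].
exists (a * b); first exact: IM.
by rewrite -mulrA -mulrBr; apply: IH.
Qed.

Lemma lspan_base I N g x : I 0 -> N x -> lspan I N g x.
Proof.
by move=> I0 Nx; elim: g => //= h g IH; exists 0; rewrite // mul0r subr0.
Qed.

Lemma lspan_gen I N g a h : I 0 -> N 0 -> I a -> h \in g -> lspan I N g (a * h).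
Proof.
move=> I0 N0 Ia; elim: g => //= k g IH; rewrite inE => /orP[/eqP <-|hg].
  by exists a; rewrite // subrr; apply: lspan_base.
by exists 0; rewrite // mul0r subr0; apply: IH.
Qed.

Lemma lspan_ind I N g X : addclosed X -> N `<=` X ->
  (forall a h, I a -> h \in g -> X (a * h)) -> lspan I N g `<=` X.
Proof.
move=> cX NX; elim: g => [//|h g IH] gX v /= [a Ia va].
rewrite -(subrK (a * h) v); apply: cX.2; last by apply: gX; rewrite ?mem_head.
by apply: IH => // b k Ib kg; apply: gX; rewrite // inE kg orbT.
Qed.

Lemma lspanS I I' N g : I `<=` I' -> lspan I N g `<=` lspan I' N g.
Proof.
move=> II'; elim: g => //= h g IH v [a Ia va].
by exists a; [exact: II' | exact: IH].
Qed.

(* The generators are eliminated one at a time, which avoids determinants. *)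
Lemma nakayama T I N g s : subring T -> submod T I -> I `<=` T -> T s ->
    submod T N ->
    (forall v, lspan T N g v -> lspan I N g (s * v)) ->
  exists e m, I m /\ forall v, lspan T N g v -> N ((s ^+ e - m) * v).
Proof.
move=> rT mI IT Ts mN sI.
have mT := subring_submod rT.
have [[I0 ID] IM] := mI; have [[N0 ND] NM] := mN; have T0 := subring0 rT.
have T1 := subring1 rT.
(* Induction on the prefix [g1] of eliminated generators: some [s ^+ e - m] sends the whole span
   into the span of the remaining [g2]. *)
suff: forall g1 g2, g = g1 ++ g2 -> exists e m,
    I m /\ forall v, lspan T N g v -> lspan T N g2 ((s ^+ e - m) * v).
  by move=> /(_ g [::]); apply; rewrite cats0.
elim/last_ind => [|g1 h IH] g2 /= defg.
  by exists 0%N, 0; split=> // v; rewrite defg subr0 mul1r.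
have [e [m [Im em]]] := IH (h :: g2) (etrans defg (cat_rcons _ _ _)).
have mg2 := lspan_submod g2 mT mN.
have T_em : T (s ^+ e - m) by apply: subringB => //; [exact: subringX | exact: IT].
have hg : h \in g by rewrite defg mem_cat mem_rcons mem_head.
(* Modulo [N], [s * h] is a combination of [g] with coefficients in [I], and [s ^+ e - m] maps each
   generator into the span of [h :: g2]; so the coefficient [i] of [h] can be taken in [I]. *)
have /= [i Ii ih] : lspan I N (h :: g2) ((s ^+ e - m) * (s * h)).
  have := sI _ (lspan_gen T0 N0 T1 hg); rewrite mul1r.
  have mIg := lspan_submod (h :: g2) mI mN.
  apply: (lspan_ind (X := [set w | lspan I N (h :: g2) ((s ^+ e - m) * w)])).
  - split=> /= [|x y Xx Xy]; first by rewrite mulr0; apply: mIg.1.1.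
    by rewrite mulrDr; apply: mIg.1.2.
  - by move=> n Nn; apply: lspan_base => //; apply: NM.
  - move=> a k Ia kg /=; rewrite mulrCA.
    have Tk : lspan T N g k by rewrite -(mul1r k); exact: lspan_gen T0 N0 T1 kg.
    apply: (lspan_ind _ _ _ (em _ Tk)
      (X := [set w | lspan I N (h :: g2) (a * w)])).
    + split=> /= [|x y Xx Xy]; first by rewrite mulr0; apply: mIg.1.1.
      by rewrite mulrDr; apply: mIg.1.2.
    + by move=> n Nn; apply: lspan_base => //; apply: NM => //; apply: IT.
    + move=> b l Tb lg; have Iab : I (a * b) by rewrite mulrC; apply: IM.
      by have := lspan_gen I0 N0 Iab lg; rewrite -mulrA.
(* With this [m1], multiplication by [s ^+ e.+1 - m1] sends [h] into the span of [g2]. *)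
pose m1 := m * s + i.
have Im1 : I m1 by apply: ID => //; rewrite mulrC; apply: IM.
have T_em1 : T (s ^+ e.+1 - m1).
  by apply: subringB => //; [exact: subringX | exact: IT].
(* The new multiplier is the product of [s ^+ e.+1 - m1] and [s ^+ e - m]: the latter leaves only
   [h] and [g2], the former removes [h]. *)
exists (e.+1 + e)%N, (s ^+ e.+1 * m + m1 * s ^+ e - m1 * m); split.
  apply: (submodB rT mI (ID _ _ _ _)); last exact: IM (IT _ Im1) Im.
    exact: IM (subringX _ rT Ts) Im.
  by rewrite mulrC; exact: IM (subringX _ rT Ts) Im1.
move=> v /em /= [a Ta va].
have -> : (s ^+ (e.+1 + e) - (s ^+ e.+1 * m + m1 * s ^+ e - m1 * m)) * v =
    (s ^+ e.+1 - m1) * ((s ^+ e - m) * v - a * h) +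
    a * ((s ^+ e - m) * (s * h) - i * h).
  have -> : s ^+ (e.+1 + e) - (s ^+ e.+1 * m + m1 * s ^+ e - m1 * m) =
      (s ^+ e.+1 - m1) * (s ^+ e - m).
    by rewrite exprD mulrBl !mulrBr -[in RHS]addrA -opprD addrA.
  have -> : (s ^+ e - m) * (s * h) - i * h = (s ^+ e.+1 - m1) * h.
    by rewrite mulrA -mulrBl (mulrBl s) /m1 exprSr -addrA -opprD.
  by rewrite -mulrA (mulrBr _ (_ * v)) (mulrCA a) subrK.
apply: mg2.1.2; first exact: mg2.2.
by apply: mg2.2 => //; apply: lspanS IT _ _.
Qed.

End SubringsAndSubmodules.

(** * Extremal intermediate rings from the finiteness of chains *)

Section FiniteChains.
Variable S : comNzRingType.
Implicit Types (A B T U : set S).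

(** Otherwise dependent choice builds an infinite [lt]-increasing sequence in [P], whose range is an
    infinite chain. An abstract [lt] covers both strict inclusion and its converse. *)
Lemma fcp_wf A B (lt : set S -> set S -> Prop) (P : set S -> Prop) :
    (forall T U V, lt T U -> lt U V -> lt T V) -> (forall T, ~ lt T T) ->
    (forall T U, lt T U -> T `<=` U \/ U `<=` T) ->
    fcp A B -> (forall T, P T -> intermediate A B T) -> (exists T, P T) ->
  exists T, P T /\ forall U, P U -> ~ lt T U.
Proof.
move=> ltT ltI ltS fAB PI [T0 PT0]; apply: contrapT => nex.
have step (x : {T | P T}) : {y : {T | P T} | lt (sval x) (sval y)}.
  case: x => T PT /=; apply: cid; apply: contrapT => nU; apply: nex.
  by exists T; split=> // U PU TU; apply: nU; exists (exist _ U PU).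
have [f [_ fS]] := dependent_choice step (exist _ T0 PT0).
pose h n := sval (f n).
have hlt i j : (i < j)%N -> lt (h i) (h j).
  elim: j => // j IHj; rewrite ltnS leq_eqVlt => /orP[/eqP -> | /IHj ij].
    exact: fS.
  exact: ltT ij (fS j).
have h_inj : {in [set: nat] &, injective h}.
  move=> i j _ _ hij; case: (ltngtP i j) => // /hlt; rewrite hij => /ltI; by [].
suff : finite_set [set: nat] by exact: infinite_nat.
rewrite -(eq_finite_set (inj_card_eq h_inj)); apply: fAB => [_ [n _ <-] | ].
  by apply: PI; exact: (svalP (f n)).
move=> _ _ [i _ <-] [j _ <-]; case: (ltngtP i j) => [/hlt/ltS|/hlt/ltS|->]//.
  by case; [right | left].
by left.
Qed.

Lemma fcp_max A B (P : set S -> Prop) : fcp A B ->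
    (forall T, P T -> intermediate A B T) -> (exists T, P T) ->
  exists T, P T /\ forall U, P U -> T `<=` U -> U = T.
Proof.
move=> fAB PI exP; have [||| T [PT Tmax]] :=
    fcp_wf (lt := fun T U => T `<` U) _ _ _ fAB PI exP.
- by move=> T U V; by move=> TU [UV _]; exact: proper_sub_trans UV.
- by move=> T; exact: properxx.
- by move=> T U [TU _]; left.
exists T; split=> // U PU TU; apply: contrapT => UT.
by apply: (Tmax U PU); apply: sub_neq_proper => // /esym.
Qed.

Lemma fcp_min A B (P : set S -> Prop) : fcp A B ->
    (forall T, P T -> intermediate A B T) -> (exists T, P T) ->
  exists T, P T /\ forall U, P U -> U `<=` T -> U = T.
Proof.
move=> fAB PI exP; have [||| T [PT Tmin]] :=
    fcp_wf (lt := fun T U => U `<` T) _ _ _ fAB PI exP.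
- by move=> T U V [UT _] VU; exact: proper_sub_trans UT.
- by move=> T; exact: properxx.
- by move=> T U [TU _]; right.
exists T; split=> // U PU UT; apply: contrapT => TU.
by apply: (Tmin U PU); exact: sub_neq_proper.
Qed.

Lemma minimal_extE A B : minimal_ext A B <->
  [/\ subring A, subring B, A `<` B &
      forall T, subring T -> A `<=` T -> T `<=` B -> T = A \/ T = B].
Proof.
split=> [[ABE AB] | [rA rB [AB BA] ABmin]].
  have [rA _ sAB] : intermediate A B A by rewrite ABE; left.
  have [rB _ _] : intermediate A B B by rewrite ABE; right.
  split=> // [|T rT AT TB]; first exact: sub_neq_proper.
  by have : intermediate A B T by []; rewrite ABE.
split=> [|eAB]; last by apply: BA; rewrite eAB.
apply/seteqP; split=> [T [rT AT TB] | T [->|->]]; first exact: ABmin.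
  by split.
by split.
Qed.

(** [V] is a minimal element among the intermediate rings strictly above [T] and inside [U]. *)
Lemma exists_minimal_ext A B T U : fcp A B ->
    intermediate A B T -> intermediate A B U -> T `<` U ->
  exists V, [/\ intermediate A B V, minimal_ext T V & V `<=` U].
Proof.
move=> fAB [rT AT TB] [rU AU UB] TU.
have [||V [[[rV AV VB] TV VU] Vmin]] := fcp_min
    (P := fun V => [/\ intermediate A B V, T `<` V & V `<=` U]) fAB.
- by move=> V [].
- by exists U; split.
exists V; split=> //; apply/minimal_extE; split=> // X rX TX XV.
have [XT|XT] := pselect (X = T); [by left | right].
apply: Vmin => //; split; last exact: subset_trans VU.
  by split=> //; [exact: subset_trans TX | exact: subset_trans VB].
by apply: sub_neq_proper => // /esym.
Qed.

End FiniteChains.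

(** * Integrality, residual isomorphisms and prime ideals *)

Section InfraIntegral.
Variables (S : comNzRingType) (R : subringClosed S).

Lemma subring_pred : subring [set` R].
Proof.
apply/subringE; split=> [|x y|x y]; rewrite /=.
- exact: rpred1.
- exact: rpredB.
- exact: rpredM.
Qed.

Lemma integral_power (x : S) : integralOver (subring_incl R) x ->
  exists n (c : nat -> S), (forall i, [set` R] (c i)) /\
    x ^+ n.+1 = \sum_(i < n.+1) c i * x ^+ i.
Proof.
case=> p pm /rootP px.
have coefE i : (map_poly (subring_incl R) p)`_i = subring_incl R p`_i.
  by rewrite coef_map.
have sizeE : size (map_poly (subring_incl R) p) = size p.
  by rewrite size_map_poly_id0 // (monicP pm) rmorph1 oner_eq0.
(* No monic polynomial has size 0, and one of size 1 equals 1 and has no root, so the degree is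
   [n.+1]. *)
have := monicP pm; rewrite lead_coefE; case sp: (size p) => [|[|n]] /= lc.
- by move: pm; rewrite (eqP (_ : p == 0)) -?size_poly_eq0 ?sp // monicE
    lead_coef0 eq_sym oner_eq0.
- move: px; rewrite horner_coef sizeE sp big_ord1 coefE lc rmorph1 expr0 mulr1.
  by move=> /eqP; rewrite oner_eq0.
exists n, (fun i => - subring_incl R p`_i); split=> [i|].
  exact: (subringN subring_pred (valP p`_i : [set` R] (subring_incl R p`_i))).
move: px; rewrite horner_coef sizeE sp big_ord_recr coefE lc rmorph1 mul1r /=.
move=> /eqP; rewrite addrC addr_eq0 => /eqP ->.
by rewrite -sumrN; apply: eq_bigr => i _; rewrite coefE mulNr.
Qed.

Definition prime_ideal (J : set S) : Prop :=
  [/\ submod [set: S] J, ~ J 1 & forall x y, J (x * y) -> J x \/ J y].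

(** Surjectivity of the residual map at [J] writes the class of [x] as a fraction of classes from
    [R]; clearing the denominator gives [s] and [r]. *)
Lemma residual_surj (J : set S) (x : S) : infra_integral R -> prime_ideal J ->
  exists s r, [/\ [set` R] s, [set` R] r, ~ J s & J (s * x - r)].
Proof.
move=> [_ resid] [[[J0 JD] JM] J1 Jp].
pose q : S -> bool := fun y => `[< J y >].
have qE y : (y \in q) = `[< J y >] by [].
have qI : idealr_closed q.
  split=> [||a u v]; rewrite !qE.
  - exact/asboolP.
  - exact/asboolP.
  - by move=> /asboolP Ju /asboolP Jv; apply/asboolP/JD => //; exact: JM.
have qP : prime_idealr_closed q.
  move=> u v; rewrite !qE => /asboolP /Jp [Ju | Jv]; apply/orP.
    by left; exact/asboolP.
  by right; exact/asboolP.
pose Q : prime_idealr S := HB.pack q (isIdealr.Build S q qI)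
  (isPrimeIdealrClosed.Build S q qP).
have [g _ gK] := resid Q.
have := gK (FracField.tofrac (quot_proj Q x)); set z := g _.
have z0 := denom_ratioP (repr z).
rewrite [in LHS](frac_ratio z) residual_map_ratio //.
have [a az] := quot_proj_surj \n_(repr z).
have [b bz] := quot_proj_surj \d_(repr z).
have b0 : quot_proj Q (subring_incl R b) != 0.
  by rewrite -quot_map_proj quot_map_eq0 -bz.
rewrite az bz !quot_map_proj  => abx.
exists (subring_incl R b), (subring_incl R a); split.
- exact: (valP b).
- exact: (valP a).
- by move: b0; rewrite quot_proj_eq0 => /asboolPn.
apply/asboolP; change (subring_incl R b * x - subring_incl R a \in Q).
rewrite -quot_proj_eq0 -(tofrac_eq0) !(rmorphB, rmorphM) /=.
rewrite -abx mulrCA mulfV ?mulr1 ?subrr //.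
by rewrite tofrac_eq0.
Qed.

(** By Zorn's lemma there is an ideal maximal among those containing [I] and avoiding the
    multiplicative set [X]; such an ideal is prime. *)
Lemma exists_prime (I X : set S) : submod [set: S] I ->
    X 1 -> (forall x y, X x -> X y -> X (x * y)) -> (forall x, I x -> ~ X x) ->
  exists J, [/\ prime_ideal J, I `<=` J & forall x, J x -> ~ X x].
Proof.
move=> mI X1 XM IX.
pose good J := [/\ submod [set: S] J, I `<=` J & forall x, J x -> ~ X x].
have [F FP Fchain|J [[J0|[mJ IJ JX]] Jmax]] :=
    @Zorn_bigcup S (fun J => J = set0 \/ good J).
- have goodF J x : F J -> J x -> good J.
    by move=> /FP [-> []|].
  have [[J [FJ [x Jx]]]|F0] := pselect (exists J, F J /\ J !=set0); last first.
    left; apply/seteqP; split=> // x [J FJ Jx]; apply: F0; exists J; split=> //.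
    by exists x.
  have [[[J0 JD] JM] IJ JX] := goodF _ _ FJ Jx.
  right; split=> [|y Iy|y [K FK Ky]].
  + split=> [|a y _ [K FK Ky]]; last first.
      by exists K => //; have [[_ KM] _ _] := goodF _ _ FK Ky; exact: KM.
    split=> [|y z [K FK Ky] [L FL Lz]]; first by exists J.
    case: (Fchain K L FK FL) => [KL|LK].
      exists L => //; have [[[_ LD] _] _ _] := goodF _ _ FL Lz.
      by apply: LD => //; exact: KL.
    exists K => //; have [[[_ KD] _] _ _] := goodF _ _ FK Ky.
    by apply: KD => //; exact: LK.
  + by exists J => //; exact: IJ.
  + by have [_ _] := goodF _ _ FK Ky; apply.
- exfalso; apply: (Jmax I); last by right; split.
  by rewrite J0; split=> // /(_ 0 mI.1.1).
have [[J0 JD] JM] := mJ.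
exists J; split=> //; split=> // [J1|x y Jxy]; first exact: (JX 1).
(* By maximality, the ideal generated by [J] and an element [z] outside it meets [X]. *)
have meet z : ~ J z -> exists j a, J j /\ X (j + a * z).
  move=> Jz; apply: contrapT => nX.
  apply: (Jmax [set w | exists j a, J j /\ w = j + a * z]).
    split=> [w Jw|sub]; first by exists w, 0; rewrite mul0r addr0.
    by apply: Jz; apply: sub; exists 0, 1; rewrite mul1r add0r.
  right; split=> [|w Iw|w [j [a [Jj ->]]] Xw].
  - split=> [|b w _ [j [a [Jj ->]]]].
      split=> [|_ _ [j [a [Jj ->]]] [k [b [Jk ->]]]].
        by exists 0, 0; rewrite mul0r addr0.
      exists (j + k), (a + b); split; first exact: JD.
      by rewrite mulrDl addrACA.
    by exists (b * j), (b * a); split; [exact: JM | rewrite mulrDr mulrA].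
  - by exists w, 0; rewrite mul0r addr0; split=> //; exact: IJ.
  - by apply: nX; exists j, a.
apply: contrapT => nJ.
have [j [a [Jj Xj]]] : exists j a, J j /\ X (j + a * x).
  by apply: meet => Jx; apply: nJ; left.
have [k [b [Jk Xk]]] : exists k b, J k /\ X (k + b * y).
  by apply: meet => Jy; apply: nJ; right.
apply: (JX _ _ (XM _ _ Xj Xk)); rewrite mulrDl; apply: (JD).
  by rewrite mulrC; apply: JM.
by rewrite mulrDr mulrACA; apply: JD; exact: JM.
Qed.

Hypothesis infraR : infra_integral R.
Hypothesis fcpR : fcp [set` R] [set: S].

Definition adjoin (T : set S) (x : S) := smallest (@subring S) (T `|` [set x]).

Lemma adjoin_subring T x : subring (adjoin T x).
Proof.
apply/subringE; split=> [V [rV _]|y z Ty Tz V VT|y z Ty Tz V VT].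
- exact: subring1.
- by apply: (subringB VT.1); [exact: Ty | exact: Tz].
- by apply: (subringM VT.1); [exact: Ty | exact: Tz].
Qed.

Lemma sub_adjoin T x : T `<=` adjoin T x.
Proof. by move=> y Ty V [_]; apply; left. Qed.

Lemma mem_adjoin T x : adjoin T x x.
Proof. by move=> V [_]; apply; right. Qed.

Lemma adjoin_sub T x V : subring V -> T `<=` V -> V x -> adjoin T x `<=` V.
Proof. by move=> rV TV Vx; apply: smallest_sub => // y [/TV|->]. Qed.

(** The monic equation of [x] expresses [x ^+ n.+1] through lower powers, so the span of the powers
    up to [x ^+ n] over any [T]-module [I] is stable under [x]. Taking [I := T] gives finite
    generation; an ideal [I] gives its extension to [adjoin T x]. *)
Lemma adjoin_span T x : subring T -> [set` R] `<=` T ->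
  exists g : seq S, [/\ 1 \in g, forall h, h \in g -> adjoin T x h &
    forall I, submod T I -> submod (adjoin T x) (lspan I [set 0] g)].
Proof.
move=> rT RT; have [n [c [Rc xn]]] := integral_power (infraR.1 x).
exists [seq x ^+ i | i <- iota 0 n.+1]; split=> [|h /mapP[i _ ->]|I mI].
- by apply/mapP; exists 0%N.
- exact: (subringX i (adjoin_subring T x) (@mem_adjoin T x)).
set g := map _ _; set D := lspan _ _ _.
have mD : submod T D by apply: lspan_submod => //; exact: submod_set0.
have I0 := mI.1.1.
have Dg a i : I a -> (i < n.+1)%N -> D (a * x ^+ i).
  by move=> Ia i_n; apply: lspan_gen => //; apply: map_f; rewrite mem_iota.
have xD d : D d -> D (x * d).
  apply: (lspan_ind (X := [set d | D (x * d)])).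
  - split=> /= [|y z Dy Dz]; first by rewrite mulr0; exact: mD.1.1.
    by rewrite mulrDr; apply: mD.1.2.
  - by move=> _ -> /=; rewrite mulr0; exact: mD.1.1.
  move=> a _ Ia /mapP[i + ->] /=; rewrite mem_iota /= add0n mulrCA -exprS => i_n.
  have [i_lt|i_ge] := ltnP i n; first exact: Dg.
  have -> : i = n by apply/eqP; rewrite eqn_leq i_ge -ltnS i_n.
  rewrite xn mulr_sumr; apply: addclosed_sum => [|k]; first exact: mD.1.
  by rewrite mulrCA; apply: mD.2; [exact: RT | exact: Dg].
split=> [|b d Tb Dd]; first exact: mD.1.
suff /(_ b Tb) : adjoin T x `<=` [set b | forall d, D d -> D (b * d)] by apply.
apply: adjoin_sub => //= [|a Ta e De]; last exact: mD.2.
apply/subringE; split=> [e|y z Dy Dz e De|y z Dy Dz e De] /=.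
- by rewrite mul1r.
- by rewrite mulrBl; apply: (submodB rT mD); [exact: Dy | exact: Dz].
- by rewrite -mulrA; apply: Dy; exact: Dz.
Qed.

(* The ideal I is pushed up to S one generator at a time, always avoiding X. *)
Lemma lying_over (B I X : set S) : intermediate [set` R] [set: S] B ->
    submod B I -> I `<=` B -> X `<=` B ->
    X 1 -> (forall x y, X x -> X y -> X (x * y)) -> (forall x, I x -> ~ X x) ->
  exists J, [/\ prime_ideal J, I `<=` J & forall x, J x -> ~ X x].
Proof.
move=> [rB RB _] mI IB XB X1 XM IX.
(* [good T] asks for an ideal of [T] above [I] avoiding [X]. FCP gives a maximal such [T], shown to
   be all of [S] by adjoining one element. *)
pose good T := [/\ subring T, B `<=` T & exists J,
  [/\ submod T J, J `<=` T, I `<=` J & forall x, J x -> ~ X x]].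
have [T [rT BT _]||T [[rT BT [J [mJ JT IJ JX]]] Tmax]] := fcp_max (P := good) fcpR.
- by split=> //; exact: subset_trans BT.
- by exists B; split=> //; exists I; split.
suff TT : T = [set: S].
  rewrite TT in mJ; have [K [pK JK KX]] := exists_prime mJ X1 XM JX.
  by exists K; split=> //; exact: subset_trans JK.
apply/seteqP; split=> // s _.
suff <- : adjoin T s = T by exact: mem_adjoin.
apply: Tmax; last exact: sub_adjoin.
have TTs := @sub_adjoin T s.
split; [exact: adjoin_subring | exact: subset_trans TTs |].
have [|g [g1 gT mg]] := adjoin_span s rT; first exact: subset_trans BT.
have mJs := mg J mJ; have J0 := mJ.1.1.
have cTs := (subring_submod (adjoin_subring T s)).1.
have span_sub K : K `<=` T -> lspan K [set 0] g `<=` adjoin T s.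
  move=> KT; apply: lspan_ind => // [_ -> |a h Ka hg]; first exact: cTs.1.
  exact: (subringM (adjoin_subring T s) (TTs _ (KT _ Ka)) (gT _ hg)).
exists (lspan J [set 0] g); split=> //.
- exact: span_sub.
- by move=> y /IJ Jy; rewrite -(mulr1 y); apply: lspan_gen.
move=> y Jy Xy.
have Ty : T y by apply: BT; exact: XB.
(* An element [y] of [X] in the extended ideal maps the span over [T] into the span over [J];
   Nakayama's lemma then puts a power of [y] in [J], but all powers of [y] are in [X]. *)
have yJ v : lspan T [set 0] g v -> lspan J [set 0] g (y * v).
  by move=> Tv; rewrite mulrC; apply: mJs.2 => //; exact: span_sub Tv.
have [e [m [Jm em]]] := nakayama rT mJ JT Ty (submod_set0 T) yJ.
have T1 : lspan T [set 0] g 1.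
  by rewrite -(mulr1 1); exact: (lspan_gen (subring0 rT) erefl (subring1 rT) g1).
have := em 1 T1; rewrite /= mulr1.
move=> /eqP; rewrite subr_eq0 => /eqP ym; apply: (JX m) => //; rewrite -ym.
by elim: e {em ym} => // e IH; rewrite exprS; apply: XM.
Qed.

(** * Minimal extensions and their conductor *)

Section MinimalExtension.
Variables A B : set S.
Hypothesis IA : intermediate [set` R] [set: S] A.
Hypothesis AB : minimal_ext A B.

Definition conductor : set S := [set c | forall b, B b -> A (c * b)].

Local Notation C := conductor.

Let rA : subring A. Proof. by case/minimal_extE: AB. Qed.
Let rB : subring B. Proof. by case/minimal_extE: AB. Qed.
Let sAB : A `<=` B. Proof. by case/minimal_extE: AB => _ _ []. Qed.
Let RA : [set` R] `<=` A. Proof. by case: IA. Qed.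
Let RB : [set` R] `<=` B. Proof. exact: subset_trans sAB. Qed.
Let rR := subring_pred.

(** This is how minimality is used: a property holds on all of [B] once the elements of [B] having
    it form a ring containing [A] and some [x] outside [A]. *)
Lemma minimal_sub T x : subring T -> A `<=` T -> T `<=` B -> T x -> ~ A x ->
  B `<=` T.
Proof.
move=> rT AT TB Tx Ax; have [_ _ _ /(_ T rT AT TB) [TA|->//]] := (minimal_extE A B).1 AB.
by rewrite TA in Tx.
Qed.

Lemma conductor_sub : C `<=` A.
Proof. by move=> c /(_ 1 (subring1 rB)); rewrite mulr1. Qed.

Lemma conductor_submod : submod B C.
Proof.
split=> [|b c Bb Cc d Bd]; last first.
  by rewrite mulrAC mulrC; apply: Cc; exact: subringM.
split=> [b Bb|c d Cc Cd b Bb]; first by rewrite mul0r; exact: subring0.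
by rewrite mulrDl; apply: (subringD rA); [exact: Cc | exact: Cd].
Qed.

Lemma conductor1 : ~ C 1.
Proof.
move=> C1; have [_ _ [_]] := (minimal_extE A B).1 AB; case=> b /C1.
by rewrite mul1r.
Qed.

Let mC := conductor_submod.

(** If [a * b] is outside [A], then [A + a B] is a ring between [A] and [B] other than [A], so it is
    [B]. As [B] is finite over [A], Nakayama's lemma for [B / A] gives [c] such that [1 - a * c]
    sends [B] into [A]. *)
Lemma conductor_maximal a : A a -> ~ C a -> exists c, A c /\ C (1 - a * c).
Proof.
move=> Aa Ca.
have [b Bb Aab] : exists2 b, B b & ~ A (a * b).
  by apply: contrapT => nb; apply: Ca => b Bb; apply: contrapT => ?; apply: nb; exists b.
have Ab : ~ A b by move=> Ab; apply: Aab; exact: subringM.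
pose V := [set y | exists a0 d, [/\ A a0, B d & y = a0 + a * d]].
have A0 := subring0 rA; have B0 := subring0 rB.
have BV : B `<=` V.
  apply: minimal_sub Aab.
  - apply/subringE; split=> [|_ _ [u [d [Au Bd ->]]] [v [e [Av Be ->]]]|].
    + by exists 1, 0; rewrite mulr0 addr0; split=> //; exact: subring1.
    + exists (u - v), (d - e); split; [exact: subringB | exact: subringB |].
      by rewrite mulrBr opprD addrACA.
    move=> _ _ [u [d [Au Bd ->]]] [v [e [Av Be ->]]].
    exists (u * v), (u * e + d * (v + a * e)); split; first exact: subringM.
      apply: (subringD rB); apply: (subringM rB) => //; first exact: sAB.
      by apply: (subringD rB); [|apply: (subringM rB) => //]; exact: sAB.
    by rewrite mulrDl (mulrDr u) (mulrDr a (u * e)) -addrA (mulrCA u) (mulrA a d).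
  - by move=> u Au; exists u, 0; rewrite mulr0 addr0.
  - move=> _ [u [d [Au Bd ->]]]; apply: (subringD rB); first exact: sAB.
    by apply: (subringM rB) => //; exact: sAB.
  - by exists 0, b; rewrite add0r.
have adjB : adjoin A b `<=` B by apply: adjoin_sub.
have Badj : B `<=` adjoin A b.
  by apply: minimal_sub Ab => //; [exact: adjoin_subring | exact: sub_adjoin | exact: mem_adjoin].
have [g [g1 gB mg]] := adjoin_span b rA RA.
have Bspan0 d : B d -> lspan A [set 0] g d.
  move=> Bd; rewrite -(mulr1 d); apply: (mg A (subring_submod rA)).2; first exact: Badj.
  by rewrite -(mulr1 1); exact: (lspan_gen A0 erefl (subring1 rA) g1).
have Bspan : B `<=` lspan A A g.
  move=> d /Bspan0; apply: lspan_ind => [|_ ->|u h Au hg].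
  - exact: lspan_addclosed (subring_submod rA).1 (subring_submod rA).1.
  - exact: lspan_base.
  - exact: lspan_gen.
have spanB : lspan A A g `<=` B.
  apply: lspan_ind => [||u h Au hg]; [exact: (subring_submod rB).1 | exact: sAB |].
  by apply: (subringM rB); [exact: sAB | exact: (adjB _ (gB _ hg))].
pose I := [set y | exists2 c, A c & y = a * c].
have mI : submod A I.
  split=> [|u _ Au [c Ac ->]]; last first.
    by exists (u * c); [exact: subringM | rewrite mulrCA].
  split=> [|_ _ [c Ac ->] [d Ad ->]]; first by exists 0; rewrite ?mulr0.
  by exists (c + d); [exact: subringD | rewrite mulrDr].
have IsA : I `<=` A by move=> _ [c Ac ->]; exact: subringM.
(* Modulo [A], [B] equals [a B]: this is the hypothesis of [nakayama] with [N := A] and [s := 1]. *)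
have sI v : lspan A A g v -> lspan I A g (1 * v).
  rewrite mul1r => /spanB /BV [u [d [Au /Bspan0 Bd ->]]].
  have cI := lspan_addclosed g mI.1 (subring_submod rA).1.
  apply: cI.2; first by apply: lspan_base => //; exact: mI.1.1.
  apply: (lspan_ind (X := [set w | lspan I A g (a * w)])) Bd.
  - split=> [|y z Iy Iz] /=; first by rewrite mulr0; exact: cI.1.
    by rewrite mulrDr; apply: cI.2.
  - by move=> _ -> /=; rewrite mulr0; exact: cI.1.
  - move=> w h Aw hg; rewrite /mkset mulrA; apply: lspan_gen => //.
      exact: mI.1.1.
    by exists w.
have [e [_ [[c Ac ->] ec]]] :=
  nakayama rA mI IsA (subring1 rA) (subring_submod rA) sI.
exists c; split=> // d /Bspan /ec; by rewrite expr1n.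
Qed.

(** Maximality gives an inverse [c] of [s] modulo the conductor in [A]; integrality of [c] over [R]
    moves it into [R]. *)
Lemma conductor_inv s : [set` R] s -> ~ C s -> exists2 t, [set` R] t & C (t * s - 1).
Proof.
move=> Rs Cs; have [c [Ac Csc]] := conductor_maximal (RA Rs) Cs.
have [n [k [Rk cn]]] := integral_power (infraR.1 c).
(* Multiplying the equation of [c] by [s ^+ n] and replacing [s * c] by 1 shows that [c] and [t]
   agree modulo the conductor. *)
pose t := \sum_(i < n.+1) k i * s ^+ (n - i).
have Rt : [set` R] t.
  apply: (addclosed_sum (N := [set` R])) => [|i].
    exact: (subring_submod rR).1.
  by apply: (subringM rR) => //; exact: subringX.
have Bc : B c by exact: sAB.
have Bs : B s by apply: RB.
have Bsc : B (s * c) by exact: subringM.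
have Cpow i : C (1 - (s * c) ^+ i).
  elim: i => [|i IH]; first by rewrite subrr; exact: mC.1.1.
  have -> : 1 - (s * c) ^+ i.+1 = (1 - s * c) + s * c * (1 - (s * c) ^+ i).
    by rewrite mulrBr mulr1 -exprS addrA subrK.
  by apply: mC.1.2 => //; exact: mC.2.
exists t => //.
suff Cct : C (c - t).
  have -> : t * s - 1 = - (1 - s * c) - s * (c - t).
    by rewrite opprB mulrBr opprB [RHS]addrC addrA subrK mulrC.
  by apply: (submodB rB mC); [exact: (submodN rB mC) | exact: mC.2].
have sum0 : (s * c) ^+ n * c - \sum_(i < n.+1) k i * s ^+ (n - i) * (s * c) ^+ i = 0.
  rewrite exprMn -mulrA -exprSr cn mulr_sumr -sumrB big1 // => i _.
  rewrite exprMn !mulrA -(mulrA (k i)) -exprD subnK; last by rewrite -ltnS.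
  by rewrite (mulrC (k i)) subrr.
have -> : c - t = c * (1 - (s * c) ^+ n) -
    \sum_(i < n.+1) k i * s ^+ (n - i) * (1 - (s * c) ^+ i).
  rewrite -[LHS]subr0 -[in LHS]sum0 mulrBr mulr1 (mulrC c).
  under [in RHS]eq_bigr do rewrite mulrBr mulr1.
  by rewrite sumrB !opprB [LHS]addrACA [RHS]addrACA (addrC (- t)).
apply: (submodB rB mC); first exact: mC.2.
apply: addclosed_sum => [|i]; first exact: mC.1.
apply: mC.2 => //; apply: (subringM rB); first by apply: RB; exact: Rk.
exact: subringX.
Qed.

(** Otherwise the products of factors [s * x - r], with [s] outside the conductor, avoid it; some
    prime of [S] above the conductor then avoids them too, against the residual isomorphism at that
    prime. *)
Lemma conductor_factor x : B x ->
  exists y r, [/\ B y, ~ C y, [set` R] r & C (y * (x - r))].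
Proof.
move=> Bx; apply: contrapT => nyr.
pose fac (p : S * S) := p.1 * x - p.2.
pose X := [set w | exists l : seq (S * S),
  (forall p, p \in l -> [/\ [set` R] p.1, [set` R] p.2 & ~ C p.1]) /\ w = \prod_(p <- l) fac p].
have XB : X `<=` B.
  move=> _ [l [lP ->]]; rewrite big_seq; elim/big_ind: _ => //.
  - exact: subring1.
  - by move=> y z; exact: subringM.
  move=> p /lP [R1 R2 _]; apply: (subringB rB); last exact: RB.
  by apply: (subringM rB) => //; exact: RB.
have IB : intermediate [set` R] [set: S] B by [].
have CB : C `<=` B by exact: subset_trans conductor_sub sAB.
have X1 : X 1 by exists [::]; rewrite big_nil.
have XM y z : X y -> X z -> X (y * z).
  move=> [l [lP ->]] [m [mP ->]]; exists (l ++ m); rewrite big_cat; split=> //.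
  by move=> p; rewrite mem_cat => /orP[/lP|/mP].
have CX z : C z -> ~ X z.
  move=> Cz [l [lP zl]]; rewrite {}zl in Cz.
  elim: l lP Cz => [|[s r] l IH] lP; first by rewrite big_nil => /conductor1.
  have lP' p : p \in l -> [/\ [set` R] p.1, [set` R] p.2 & ~ C p.1].
    by move=> pl; apply: lP; rewrite inE pl orbT.
  have [/= Rs Rr Cs] := lP _ (mem_head _ _).
  rewrite big_cons /fac /=; set w := \prod_(p <- l) _ => Cw.
  have Xw : X w by exists l.
  have [t Rt Cts] := conductor_inv Rs Cs.
  (* Once [s] is inverted modulo the conductor, [s * x - r] becomes [x - t * r], and the remaining
     product [w] is an excluded [y]. *)
  apply: nyr; exists w, (t * r); split; [exact: XB | exact: IH | exact: subringM |].
  have -> : w * (x - t * r) = t * ((s * x - r) * w) - (w * x) * (t * s - 1).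
    have -> : t * ((s * x - r) * w) = w * x * (t * s) - w * (t * r).
      rewrite mulrBl mulrBr; congr (_ - _); last by rewrite mulrA mulrC.
      by rewrite -(mulrA s) (mulrA t) (mulrC x) [LHS]mulrC.
    by rewrite (mulrBr (w * x)) mulr1 opprB [RHS]addrC addrA subrK mulrBr.
  apply: (submodB rB mC); apply: mC.2 => //; first exact: RB.
  by apply: (subringM rB) => //; exact: XB.
have [J [pJ CJ JX]] := lying_over IB mC CB XB X1 XM CX.
have [s [r [Rs Rr Js Jx]]] := residual_surj x infraR pJ.
apply: (JX _ Jx); exists [:: (s, r)]; rewrite big_seq1; split=> // p.
by rewrite inE => /eqP -> /=; split=> // /CJ.
Qed.

(** If [a - r] were outside the conductor, it would be invertible modulo it, and [y * (a - r)] in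
    the conductor would force [y] into it. *)
Lemma conductor_residue a : A a -> exists2 r, [set` R] r & C (a - r).
Proof.
move=> Aa; have [y [r [By Cy Rr Cyr]]] := conductor_factor (sAB Aa).
exists r => //; apply: contrapT => Car; apply: Cy.
have [|c [Ac Cc]] := conductor_maximal _ Car; first exact: (subringB rA _ (RA Rr)).
have -> : y = y * (1 - (a - r) * c) + c * (y * (a - r)).
  by rewrite mulrBr mulr1 (mulrC c) mulrA subrK.
by apply: mC.1.2; apply: mC.2 => //; exact: sAB.
Qed.

Lemma minimal_generation x b : B x -> ~ A x -> B b ->
  exists a r, [/\ A a, [set` R] r & b = a + r * x].
Proof.
move=> Bx Ax Bb; have [y [r [By Cy Rr Cyr]]] := conductor_factor Bx.
(* If [y] were in [A], it would be invertible modulo the conductor, so [x - r] and hence [x] would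
   be in [A]. *)
have Ay : ~ A y.
  move=> Ay; apply: Ax; have [c [Ac Cc]] := conductor_maximal Ay Cy.
  have -> : x = (x - r) * (1 - y * c) + c * (y * (x - r)) + r.
    by rewrite mulrBr mulr1 (mulrC (x - r)) -mulrA (mulrCA c) !subrK.
  apply: (subringD rA); last exact: RA.
  apply: conductor_sub; apply: mC.1.2; apply: mC.2 => //; last exact: sAB.
  by apply: (subringB rB) => //; exact: RB.
(* Modulo the conductor, [B] acts on [y] through scalars of [R]: the elements acting so form a ring
   containing [x] and, by [conductor_residue], [A]. *)
have yB : B `<=` [set d | B d /\ exists2 u, [set` R] u & C (y * d - u * y)].
  apply: minimal_sub Ax => //.
  - apply/subringE; split=> [|d e [Bd [u Ru Cu]] [Be [v Rv Cv]]|].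
    + split; first exact: subring1.
      exists 1; first exact: subring1.
      by rewrite mulr1 mul1r subrr; exact: mC.1.1.
    + split; first exact: subringB.
      exists (u - v); first exact: subringB.
      have -> : y * (d - e) - (u - v) * y = (y * d - u * y) - (y * e - v * y).
        by rewrite mulrBr mulrBl !opprB [LHS]addrACA [RHS]addrACA (addrC (- (y * e))).
      exact: (submodB rB mC).
    move=> d e [Bd [u Ru Cu]] [Be [v Rv Cv]].
    split; first exact: subringM.
    exists (u * v); first exact: subringM.
    have -> : y * (d * e) - u * v * y = e * (y * d - u * y) + u * (y * e - v * y).
      rewrite !mulrBr (mulrCA e u) (mulrC e y) addrA subrK.
      by rewrite (mulrCA e) (mulrC e) !mulrA.
    by apply: mC.1.2; apply: mC.2 => //; exact: RB.
  - move=> a Aa; split; first exact: sAB.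
    have [u Ru Cu] := conductor_residue Aa; exists u => //.
    by rewrite (mulrC u) -mulrBr; apply: mC.2.
  - by move=> d [].
  - split=> //; exists r => //.
    by rewrite (mulrC r) -mulrBr.
have gen : B `<=` [set d | exists a u, [/\ A a, [set` R] u & d = a + u * y]].
  apply: minimal_sub Ay.
  - apply/subringE; split=> [|_ _ [a [u [Aa Ru ->]]] [c [v [Ac Rv ->]]]|].
    + exists 1, 0; split; [exact: subring1 | exact: (subring0 rR) |].
      by rewrite mul0r addr0.
    + exists (a - c), (u - v); split; [exact: subringB | exact: subringB |].
      by rewrite mulrBl opprD addrACA.
    move=> _ _ [a [u [Aa Ru ->]]] [c [v [Ac Rv ->]]].
    (* Apart from [a * c], the product is [y] times this element of [B], hence [k * y] modulo the
       conductor. *)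
    have [_ [k Rk Ck]] : B (a * v + (c + v * y) * u) /\
        exists2 k, [set` R] k & C (y * (a * v + (c + v * y) * u) - k * y).
      apply: yB; apply: (subringD rB); apply: (subringM rB);
        do ?[exact: sAB | exact: RB].
      apply: (subringD rB); first exact: sAB.
      by apply: (subringM rB) => //; exact: RB.
    exists (a * c + (y * (a * v + (c + v * y) * u) - k * y)), k; split=> //.
      by apply: (subringD rA); [exact: subringM | exact: conductor_sub].
    rewrite -addrA subrK mulrDl mulrDr -addrA; congr (_ + _).
    rewrite [RHS]mulrDr; congr (_ + _); first by rewrite [LHS]mulrA [LHS]mulrC.
    by rewrite -mulrA [LHS]mulrC -mulrA.
  - by move=> a Aa; exists a, 0; rewrite mul0r addr0; split=> //; exact: (subring0 rR).
  - move=> _ [a [u [Aa Ru ->]]]; apply: (subringD rB); first exact: sAB.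
    by apply: (subringM rB) => //; exact: RB.
  - by exists 0, 1; rewrite mul1r add0r; split; [exact: subring0 | exact: (subring1 rR) |].
have [a [v [Aa Rv xE]]] := gen _ Bx; have [d [w [Ad Rw bE]]] := gen _ Bb.
have [t Rt Ct] : exists2 t, [set` R] t & C (t * v - 1).
  apply: conductor_inv => // Cv; apply: Ax; rewrite xE.
  by apply: (subringD rA) => //; exact: Cv.
(* In [b = d + w * y], the element [y] is rewritten as [t * (x - a) - (t * v - 1) * y], whose last
   term lies in [A]. *)
exists (d - w * t * a - w * ((t * v - 1) * y)), (w * t); split.
- apply: (subringB rA).
    apply: (subringB rA) => //; apply: (subringM rA) => //.
    by apply: (subringM rA); exact: RA.
  by apply: (subringM rA); [exact: RA | exact: Ct].
- exact: subringM.
have -> : w * ((t * v - 1) * y) = w * t * (v * y) - w * y.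
  by rewrite mulrBl mul1r mulrBr !mulrA.
by rewrite bE xE mulrDr opprB addrACA !subrK.
Qed.

End MinimalExtension.

End InfraIntegral.

(** * Composita and sums of subrings, and lengths of chains *)

Section Lattice.
Variable S : comNzRingType.
Implicit Types A B T U V W X : set S.

Lemma subringI T U : subring T -> subring U -> subring (T `&` U).
Proof.
move=> rT rU; apply/subringE; split=> [|x y [Tx Ux] [Ty Uy]|x y [Tx Ux] [Ty Uy]].
- by split; exact: subring1.
- by split; exact: subringB.
- by split; exact: subringM.
Qed.

Section Compositum.
Variables T U : set S.
Hypotheses (rT : subring T) (rU : subring U).

Lemma compositum_subring : subring (compositum T U).
Proof.
rewrite compositumE //; apply/subringE; split=> [V [rV _]|x y Tx Ty V VT|x y Tx Ty V VT].
- exact: subring1.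
- by apply: (subringB VT.1); [exact: Tx | exact: Ty].
- by apply: (subringM VT.1); [exact: Tx | exact: Ty].
Qed.

Lemma compositum_subl : T `<=` compositum T U.
Proof. by rewrite compositumE // => x Tx V [_]; apply; left. Qed.

Lemma compositum_subr : U `<=` compositum T U.
Proof. by rewrite compositumE // => x Tx V [_]; apply; right. Qed.

Lemma compositum_min V : subring V -> T `<=` V -> U `<=` V -> compositum T U `<=` V.
Proof.
by move=> rV TV UV; rewrite compositumE //; apply: smallest_sub => // x [/TV|/UV].
Qed.

Lemma compositum_absorb : T `<=` U -> compositum T U = U.
Proof.
move=> TU; apply/seteqP; split; last exact: compositum_subr.
exact: compositum_min.
Qed.

Lemma setsum_subl : T `<=` setsum T U.
Proof. by move=> t Tt; exists t => //; exists 0; [exact: subring0 | rewrite addr0]. Qed.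

Lemma setsum_subr : U `<=` setsum T U.
Proof. by move=> u Uu; exists 0; [exact: subring0 | exists u; rewrite ?add0r]. Qed.

Lemma setsum_sub V : subring V -> T `<=` V -> U `<=` V -> setsum T U `<=` V.
Proof. by move=> rV TV UV _ [t Tt [u Uu <-]]; apply: subringD; [|exact: TV|exact: UV]. Qed.

Lemma setsum_compositum : subring (setsum T U) -> setsum T U = compositum T U.
Proof.
move=> rTU; apply/seteqP; split.
  exact: setsum_sub compositum_subring compositum_subl compositum_subr.
exact: compositum_min rTU setsum_subl setsum_subr.
Qed.

End Compositum.

Lemma compositumC T U : subring T -> subring U -> compositum T U = compositum U T.
Proof. by move=> rT rU; rewrite !compositumE // setUC. Qed.

Lemma setsumC T U : setsum T U = setsum U T.
Proof.
apply/seteqP; split=> _ [t Tt [u Uu <-]].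
  by exists u => //; exists t => //; rewrite addrC.
by exists u => //; exists t => //; rewrite addrC.
Qed.

Lemma setsumA T U V : setsum T (setsum U V) = setsum (setsum T U) V.
Proof.
apply/seteqP; split=> [_ [t Tt [_ [u Uu [v Vv <-]] <-]]|_ [_ [t Tt [u Uu <-]] [v Vv <-]]].
  by exists (t + u); [exists t => //; exists u | exists v; rewrite ?addrA].
by exists t => //; exists (u + v); [exists u => //; exists v | rewrite addrA].
Qed.

Lemma setsum_absorb T U : subring T -> subring U -> T `<=` U -> setsum T U = U.
Proof.
move=> rT rU TU; apply/seteqP; split; last exact: setsum_subr.
exact: setsum_sub.
Qed.

(* A chain of length n from A up to subrings of B, of which the last one may
   be replaced by B itself. *)
Fixpoint has_chain n A B : Prop :=
  if n is n'.+1 then exists C, [/\ subring C, C `<` B & has_chain n' A C]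
  else A `<=` B.

Lemma has_chain_sub n A B : has_chain n A B -> A `<=` B.
Proof.
elim: n B => [//|n IH] B [C [_ [CB _] /IH AC]]; exact: subset_trans CB.
Qed.

Lemma has_chainS n A B B' : B `<=` B' -> has_chain n A B -> has_chain n A B'.
Proof.
case: n => [|n] BB' /=; first by move=> AB; exact: subset_trans BB'.
by move=> [C [rC CB hC]]; exists C; split=> //; exact: proper_sub_trans BB'.
Qed.

(** A chain with [n.+1] elements is peeled from its largest element; conversely [B] is put on top of
    a chain whose members lie strictly below it. *)
Lemma chain_lengthsP n A B : subring A -> subring B ->
  chain_lengths A B n <-> has_chain n A B.
Proof.
move=> rA rB; split.
  move=> [C [CI Cch Cn]].
  (* The induction needs the chain to end at its own greatest element, which may be smaller than
     [B]. *)
  suff [X [CX _ hX]] : exists X, [/\ C X, forall Y, C Y -> Y `<=` X & has_chain n A X].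
    by apply: has_chainS hX; have [] := CI _ CX.
  have chain_max m (D : set (set S)) : is_chain D -> (D #= `I_m.+1)%card ->
      exists2 X, D X & forall Y, D Y -> Y `<=` X.
    elim: m D => [|m IH] D Dch /eq_cardSP [X DX DX1].
      exists X => // Y DY; apply: contrapT => YX.
      move: DX1; rewrite II0 card_eq0 => /eqP D0.
      suff : (D `\ X) Y by rewrite D0.
      by split=> // YX'; apply: YX; rewrite YX'.
    have [|Z [DZ _] Zmax] := IH _ _ DX1.
      by move=> Y Y' [DY _] [DY' _]; exact: Dch.
    have [XZ|ZX] := Dch X Z DX DZ.
      exists Z => // Y DY; have [->//|YX] := pselect (Y = X); exact: Zmax.
    exists X => // Y DY; have [->//|YX] := pselect (Y = X).
    by apply: subset_trans ZX; exact: Zmax.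
  elim: n C CI Cch Cn => [|n IH] C CI Cch Cn.
    have [X CX Xmax] := chain_max _ _ Cch Cn.
    by exists X; split=> //; have [] := CI _ CX.
  have [X CX Xmax] := chain_max _ _ Cch Cn.
  have CXn : (C `\ X #= `I_n.+1)%card.
    have /finite_setP [m Cm] : finite_set (C `\ X).
      by apply: finite_setD; apply/finite_setP; exists n.+2.
    have Cm1 : (C #= `I_m.+1)%card by apply/eq_cardSP; exists X.
    have := card_eq_trans (card_esym Cm1) Cn.
    by move=> /card_eq_II [<-].
  have [||Y [[CY YX] Ymax hY]] := IH _ _ _ CXn.
  - by move=> Y [CY _]; exact: CI.
  - by move=> Y Y' [DY _] [DY' _]; exact: Cch.
  exists X; split=> //; exists Y; split=> //; first by have [] := CI _ CY.
  by apply: sub_neq_proper => //; exact: Xmax.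
elim: n B rB => [|n IH] B rB /=.
  move=> AB; exists [set B]; split=> [_ ->|_ _ -> ->|].
  - by split.
  - by left.
  - exact: card_set1.
move=> [X [rX XB /(IH _ rX) [C [CI Cch Cn]]]].
have CX Y : C Y -> Y `<=` X by move=> /CI [].
have CB : ~ C B by move=> /CX; case: XB.
have AB : A `<=` B.
  have [Y CY _] : exists2 Y, C Y & (C `\ Y #= `I_n)%card by apply/eq_cardSP.
  have [_ AY YX] := CI _ CY; apply: subset_trans XB.1; exact: subset_trans YX.
exists (C `|` [set B]); split=> [Y [/CI [rY AY YX]|->]|Y Z|].
- by split=> //; exact: subset_trans XB.1.
- by split.
- move=> [CY|->] [CZ|->]; [exact: Cch | left | right | by left].
    by apply: subset_trans XB.1; exact: CX.
  by apply: subset_trans XB.1; exact: CX.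
apply/eq_cardSP; exists B; first by right.
suff -> : (C `|` [set B]) `\ B = C by [].
apply/seteqP; split=> [Y [[//|//]]|Y CY]; split; first by left.
by move=> YB; apply: CB; rewrite -YB.
Qed.

(** It trades the supremum in the extended integers for an attained maximum or for unboundedness. *)
Lemma ext_lengthP A B : subring A -> subring B -> A `<=` B ->
  (exists n, [/\ ext_length A B = (Posz n)%:E, has_chain n A B &
                 forall m, has_chain m A B -> (m <= n)%N]) \/
  (ext_length A B = +oo%E /\ forall n, exists2 m, has_chain m A B & (n < m)%N).
Proof.
move=> rA rB AB.
have LP n := chain_lengthsP n rA rB.
have [|ub lb] := @ext_length_supremum S A B.
  by exists 0%N; apply/LP.
have [[N Nub]|nub] := pselect (exists N, forall m, has_chain m A B -> (m <= N)%N).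
  left; have ex0 : exists n, `[< has_chain n A B >] by exists 0%N; apply/asboolP.
  have ubN i : `[< has_chain i A B >] -> (i <= N)%N by move=> /asboolP /Nub.
  case: (ex_maxnP ex0 ubN) => n /asboolP hn nmax; exists n; split=> //; last first.
    by move=> m hm; apply: nmax; exact/asboolP.
  apply/eqP; rewrite eq_le; apply/andP; split; last first.
    by apply: ub; exists n => //; exact/LP.
  apply: lb => _ [m /LP hm <-]; rewrite lee_fin lez_nat.
  by apply: nmax; exact/asboolP.
right; split=> [|n]; last first.
  apply: contrapT => nm; apply: nub; exists n => m hm; rewrite leqNgt.
  by apply/negP => nm'; apply: nm; exists m.
(* The trivial chain of length 0 excludes [-oo] and negative values; a natural number would bound
   the lengths. *)
case: (ext_length A B) ub => [z| |] ub //; exfalso; last first.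
  by have := ub _ (ex_intro2 _ _ 0%N ((LP 0%N).2 AB) erefl).
case: z ub => [N|N] ub; last first.
  by have := ub _ (ex_intro2 _ _ 0%N ((LP 0%N).2 AB) erefl).
apply: nub; exists N => m /LP hm.
by have := ub _ (ex_intro2 _ _ m hm erefl); rewrite lee_fin lez_nat.
Qed.

Lemma ext_length_eq A B n : subring A -> subring B -> A `<=` B ->
  ext_length A B = (Posz n)%:E <->
  has_chain n A B /\ forall m, has_chain m A B -> (m <= n)%N.
Proof.
move=> rA rB AB; case: (ext_lengthP rA rB AB) => [[k [-> hk kmax]]|[-> ub]].
  split=> [[<-//]|[hn nmax]]; congr (Posz _)%:E; apply/eqP.
  by rewrite eqn_leq nmax //= kmax.
split=> // [[_ nmax]]; have [m /nmax] := ub n.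
by rewrite leqNgt => /negP.
Qed.

Lemma minimal_ext_length A B : minimal_ext A B -> ext_length A B = 1%:E.
Proof.
move=> /minimal_extE [rA rB AB ABmin].
apply/(@ext_length_eq A B 1%N rA rB AB.1); split; first by exists A; split.
move=> [|[|m]] // [C [rC CB [D [rD DC hD]]]].
have AD := has_chain_sub hD; have AC := subset_trans AD DC.1.
have [CA|CB'] := ABmin C rC AC CB.1; last by have := proper_neq CB.
by rewrite CA in DC; case: DC => _ /(_ AD).
Qed.

End Lattice.

(** * The implications between the five conditions *)

Section Conditions.
Variable S : comNzRingType.
Implicit Types A B T U V W X : set S.

Lemma intermediate_compositum A B T U : subring B ->
  intermediate A B T -> intermediate A B U -> intermediate A B (compositum T U).
Proof.
move=> rB [rT AT TB] [rU AU UB]; split.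
- exact: compositum_subring.
- exact: subset_trans (compositum_subl rT rU).
- exact: compositum_min.
Qed.

Lemma intermediateI A B T U :
  intermediate A B T -> intermediate A B U -> intermediate A B (T `&` U).
Proof.
move=> [rT AT TB] [rU AU UB]; split; first exact: subringI.
- by move=> x Ax; split; [exact: AT | exact: AU].
- by move=> x [Tx _]; exact: TB.
Qed.

(** As for submodules: when [x = t + u] with [x] and [t] in [T1], the term [u] also lies in [T1]. *)
Lemma delta_modular A B : delta_ext A B -> modular_ext A B.
Proof.
move=> dAB T1 T2 T3 I1 I2 I3 T21.
have [r1 _ _] := I1; have [r2 _ _] := I2; have [r3 _ _] := I3.
have r13 := subringI r1 r3.
apply/seteqP; split=> [x [T1x]|].
  rewrite -(setsum_compositum r2 r3); last by have [] := dAB _ _ I2 I3.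
  move=> [t T2t [u T3u tux]]; rewrite -tux.
  apply: (subringD (compositum_subring r2 r13)).
    exact: compositum_subl.
  apply: compositum_subr => //; split=> //.
  have -> : u = x - t by rewrite -tux addrC addKr.
  by apply: subringB => //; exact: T21.
apply: compositum_min => // [|x T2x|x [T1x T3x]].
- by apply: subringI => //; exact: compositum_subring.
- by split; [exact: T21 | exact: compositum_subl].
- by split=> //; exact: compositum_subr.
Qed.

(** * Additivity of lengths under the modular law *)

Section ModularLength.
Variables A B T U : set S.
Hypotheses (rB : subring B) (modAB : modular_ext A B).
Hypotheses (IT : intermediate A B T) (IU : intermediate A B U).

Let W := T `&` U.
Let rT : subring T. Proof. by case: IT. Qed.
Let rU : subring U. Proof. by case: IU. Qed.
Let AW : A `<=` W. Proof. by have [] := intermediateI IT IU. Qed.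
Let TUB : compositum T U `<=` B.
Proof. by have [] := intermediate_compositum rB IT IU. Qed.

(* By modularity [X |-> (X `&` T, XT `&` U)] is strictly increasing. *)
Lemma modular_chain_split n X : subring X -> X `<=` compositum T U ->
    has_chain n W X ->
  exists p q, [/\ n = (p + q)%N, has_chain p W (X `&` T) &
                  has_chain q W (compositum X T `&` U)].
Proof.
elim: n X => [|n IH] X rX XTU /=.
  move=> WX; exists 0%N, 0%N; split=> // x [Tx Ux]; split=> //; first by apply: WX.
  exact: compositum_subr.
move=> [C [rC CX hC]].
have [p [q [-> hp hq]]] := IH C rC (subset_trans CX.1 XTU) hC.
have rXT := compositum_subring rX rT; have rCT := compositum_subring rC rT.
have sCT : C `&` T `<=` X `&` T by move=> x [/CX.1].
have sCTU : compositum C T `&` U `<=` compositum X T `&` U.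
  move=> x [Cx Ux]; split=> //; apply: (compositum_min rC rT rXT) Cx.
    exact: subset_trans CX.1 (compositum_subl rX rT).
  exact: compositum_subr.
have [eT|neT] := pselect (C `&` T = X `&` T); last first.
  exists p.+1, q; split=> //; last exact: has_chainS hq.
  by exists (C `&` T); split=> //; [exact: subringI | exact: sub_neq_proper].
have [eU|neU] := pselect (compositum C T `&` U = compositum X T `&` U); last first.
  exists p, q.+1; rewrite addnS; split=> //; first exact: has_chainS hp.
  by exists (compositum C T `&` U); split=> //; [exact: subringI | exact: sub_neq_proper].
exfalso; apply: (proper_neq CX).
have AC : A `<=` C := subset_trans AW (has_chain_sub hC).
have IC : intermediate A B C.
  by split=> //; exact: subset_trans CX.1 (subset_trans XTU TUB).
have IX : intermediate A B X.
  by split=> //; [exact: subset_trans CX.1 | exact: subset_trans TUB].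
(* The modular law, applied to [T] inside [Y T], recovers [Y T] from its intersection with [U]. *)
have joinE Y : intermediate A B Y -> Y `<=` compositum T U ->
    compositum Y T = compositum T (compositum Y T `&` U).
  move=> IY YTU; have [rY _ _] := IY.
  rewrite -(modAB (intermediate_compositum rB IY IT) IT IU); last exact: compositum_subr.
  apply/esym/setIidl; apply: compositum_min => //; last exact: compositum_subl.
  exact: compositum_subring.
have eXT : compositum C T = compositum X T.
  by rewrite (joinE C) ?eU -?joinE //; exact: subset_trans CX.1 XTU.
have -> : X = X `&` compositum C T.
  by apply/esym/setIidl; rewrite eXT; exact: compositum_subl.
(* By the modular law [X] is the compositum of [C] with the intersection of [X] and [T], which by
   [eT] already lies in [C]. *)
rewrite (modAB IX IC IT CX.1) -eT compositumC ?compositum_absorb //;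
  exact: subringI.
Qed.

(** Joining with [T] is strictly increasing between [W] and [U]: if [T C = T V] with [C] inside [V],
    modularity gives [V = C], because [V] meets [T] inside [W]. *)
Lemma modular_chain_cat p q V : subring V -> V `<=` U ->
  has_chain p W T -> has_chain q W V -> has_chain (p + q) W (compositum T V).
Proof.
move=> rV VU hp; elim: q V rV VU => [|q IH] V rV VU.
  by move=> WV; rewrite addn0; apply: has_chainS hp; exact: compositum_subl.
rewrite addnS /= => -[C [rC CV hC]].
have CU := subset_trans CV.1 VU; have WC := has_chain_sub hC.
have sTC : compositum T C `<=` compositum T V.
  apply: compositum_min => //; [exact: compositum_subring | exact: compositum_subl |].
  exact: subset_trans CV.1 (compositum_subr rT rV).
exists (compositum T C); split; [exact: compositum_subring | | exact: IH].
apply: sub_neq_proper => // eTC; apply: (proper_neq CV).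
have UB : U `<=` B by case: IU.
have AC : A `<=` C by exact: subset_trans WC.
have IC : intermediate A B C by split=> //; exact: subset_trans UB.
have IV : intermediate A B V.
  by split=> //; [exact: subset_trans CV.1 | exact: subset_trans UB].
have -> : V = V `&` compositum C T.
  by apply/esym/setIidl; rewrite compositumC // eTC; exact: compositum_subr.
rewrite (modAB IV IC IT CV.1) compositumC ?compositum_absorb //; do ?exact: subringI.
by move=> x [Vx Tx]; apply: WC; split=> //; exact: VU.
Qed.

Lemma modular_length :
  (ext_length W T + ext_length W U = ext_length W (compositum T U))%E.
Proof.
have rW := subringI rT rU; have rTU := compositum_subring rT rU.
have WT : W `<=` T := @subIsetl _ T U; have WU : W `<=` U := @subIsetr _ T U.
have WTU : W `<=` compositum T U := subset_trans WT (compositum_subl rT rU).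
have cat p q : has_chain p W T -> has_chain q W U ->
    has_chain (p + q) W (compositum T U) by exact: modular_chain_cat.
case: (ext_lengthP rW rTU WTU) => [[n [-> hn nmax]]|[-> ub]]; last first.
  case: (ext_lengthP rW rT WT) => [[p [-> _ pmax]]|[-> _]];
    case: (ext_lengthP rW rU WU) => [[q [-> _ qmax]]|[-> _]] //.
  (* Finite lengths [p] and [q] cannot face an infinite one: a chain longer than [p + q] splits into
     two chains, one of which is too long. *)
  have [m hm] := ub (p + q)%N.
  have [p' [q' [-> hp hq]]] := modular_chain_split rTU (@subset_refl _ _) hm.
  rewrite ltnNge => /negP []; apply: leq_add; [apply: pmax | apply: qmax].
    by apply: has_chainS hp; exact: subIsetr.
  by apply: has_chainS hq; exact: subIsetr.
have [p [q [npq hp hq]]] := modular_chain_split rTU (@subset_refl _ _) hn.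
have {}hp : has_chain p W T by apply: has_chainS hp; exact: subIsetr.
have {}hq : has_chain q W U by apply: has_chainS hq; exact: subIsetr.
have /(ext_length_eq p rW rT WT) -> :
    has_chain p W T /\ forall m, has_chain m W T -> (m <= p)%N.
  split=> // m hm; rewrite -(leq_add2r q) -npq; exact: nmax (cat _ _ hm hq).
have /(ext_length_eq q rW rU WU) -> :
    has_chain q W U /\ forall m, has_chain m W U -> (m <= q)%N.
  split=> // m hm; rewrite -(leq_add2l p) -npq; exact: nmax (cat _ _ hp hm).
by rewrite npq.
Qed.

End ModularLength.

Lemma minimal_ext_cap T U V : minimal_ext T U -> minimal_ext T V -> U <> V ->
  U `&` V = T.
Proof.
move=> /minimal_extE [_ rU TU Umin] /minimal_extE [_ rV TV Vmin] UV.
have TUV : T `<=` U `&` V by move=> x Tx; split; [exact: TU.1 | exact: TV.1].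
have [//|/setIidPl sUV] := Umin _ (subringI rU rV) TUV (@subIsetl _ _ _).
by have [UT|] := Vmin U rU TU.1 sUV; [have := proper_neq TU; rewrite UT | ].
Qed.

(** A ring strictly between [T] and the compositum would give a chain of length 3 through [T]. *)
Lemma length2_minimal T U : subring T -> subring U ->
    minimal_ext (T `&` U) T -> minimal_ext (T `&` U) U ->
    ext_length (T `&` U) (compositum T U) = 2%:E ->
  minimal_ext T (compositum T U).
Proof.
move=> rT rU /minimal_extE [rW _ WT _] /minimal_extE [_ _ WU _].
have rTU := compositum_subring rT rU; have TTU := compositum_subl rT rU.
move=> /(@ext_length_eq S _ _ 2%N rW rTU (subset_trans WT.1 TTU)) [_ max2].
apply/minimal_extE; split=> // [|X rX TX XTU].
  apply: sub_neq_proper => // eT; apply: (proper_neq WU).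
  by apply: setIidr; rewrite eT; exact: compositum_subr.
apply: contrapT => nX.
have /max2 // : has_chain 3 (T `&` U) (compositum T U).
exists X; split=> //.
  by apply: sub_neq_proper => // eX; apply: nX; right.
exists T; split=> //; last by exists (T `&` U); split.
by apply: sub_neq_proper => // eX; apply: nX; left.
Qed.

Definition additive_lengths A B : Prop := forall T U,
  intermediate A B T -> intermediate A B U ->
  (ext_length (T `&` U) T + ext_length (T `&` U) U =
   ext_length (T `&` U) (compositum T U))%E.

Definition minimal_pairs_length2 A B : Prop := forall T U V,
  intermediate A B T -> intermediate A B U -> intermediate A B V ->
  minimal_ext T U -> minimal_ext T V -> U <> V ->
  ext_length T (compositum U V) = 2%:E.

Lemma additive_semimodular A B : additive_lengths A B -> semimodular_ext A B.
Proof.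
move=> addAB.
suff half T U : intermediate A B T -> intermediate A B U ->
    minimal_ext (T `&` U) T -> minimal_ext (T `&` U) U ->
    minimal_ext T (compositum T U).
  move=> T U IT IU mT mU; have [rT _ _] := IT; have [rU _ _] := IU.
  split; first exact: half.
  by rewrite compositumC //; apply: half => //; rewrite setIC.
move=> IT IU mT mU; have [rT _ _] := IT; have [rU _ _] := IU.
apply: length2_minimal => //.
by rewrite -addAB // !minimal_ext_length.
Qed.

(** The chain through [U] has length 2; a longer one is excluded by exchanging its first step with
    [U], as in the Jordan-Hölder argument. *)
Lemma semimodular_minimal_pairs A B : subring B -> fcp A B ->
  semimodular_ext A B -> minimal_pairs_length2 A B.
Proof.
move=> rB fAB smAB T U V IT IU IV mU mV UV.
have [rT _ _] := IT; have [rU _ _] := IU; have [rV _ _] := IV.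
have capT := minimal_ext_cap mU mV UV.
have [mUUV _] : minimal_ext U (compositum U V) /\ minimal_ext V (compositum U V).
  by apply: smAB; rewrite ?capT.
have [_ rUV UUV UUVmin] := (minimal_extE _ _).1 mUUV.
have [_ _ TU _] := (minimal_extE _ _).1 mU.
apply/(@ext_length_eq S _ _ 2%N rT rUV (subset_trans TU.1 UUV.1)); split.
  by exists U; split=> //; exists T; split.
move=> [|[|[|m]]] // [C2 [r2 C2UV [C1 [r1 C12 [C0 [r0 C01 /has_chain_sub TC0]]]]]].
have IUV := intermediate_compositum rB IU IV.
have TC1 : T `<` C1 := sub_proper_trans TC0 C01.
have I1 : intermediate A B C1.
  have [_ AT _] := IT; have [_ _ UVB] := IUV.
  split=> //; first exact: subset_trans TC1.1.
  exact: subset_trans C12.1 (subset_trans C2UV.1 UVB).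
(* If [X = U], then [C2] lies strictly between [U] and [U V]. Otherwise [X U = U V] is minimal over
   [X], and [C2] lies strictly between them. *)
have [X [IX mX XC1]] := exists_minimal_ext fAB IT I1 TC1.
have [rX _ _] := IX.
have XC2 : X `<` C2 := sub_proper_trans XC1 C12.
have [eXU|neXU] := pselect (X = U).
  have UC2 : U `<` C2 by rewrite -eXU.
  have [e|e] := UUVmin C2 r2 UC2.1 C2UV.1.
    by case: (proper_neq UC2).
  by case: (proper_neq C2UV).
have capX := minimal_ext_cap mX mU neXU.
have [mXXU mUXU] : minimal_ext X (compositum X U) /\ minimal_ext U (compositum X U).
  by apply: smAB; rewrite ?capX.
have [_ rXU UXU _] := (minimal_extE _ _).1 mUXU.
have XUUV : compositum X U `<=` compositum U V.
  apply: compositum_min => //; last exact: UUV.1.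
  exact: subset_trans XC2.1 C2UV.1.
have [e|e] := UUVmin _ rXU UXU.1 XUUV; first by case: (proper_neq UXU).
have [_ _ _ /(_ C2 r2 XC2.1)] := (minimal_extE _ _).1 mXXU.
rewrite e => /(_ C2UV.1) [e2|e2].
  by case: (proper_neq XC2).
by case: (proper_neq C2UV).
Qed.

Lemma minimal_pairs_delta (R : subringClosed S) :
    infra_integral R -> fcp [set` R] [set: S] ->
  minimal_pairs_length2 [set` R] [set: S] -> delta_ext [set` R] [set: S].
Proof.
move=> infraR fcpR len2; have rR := subring_pred R.
(* The common subring [W] carries the Noetherian induction; the conclusion is the case [W = R]. *)
pose good W := forall T U, intermediate [set` R] [set: S] T ->
  intermediate [set` R] [set: S] U -> W `<=` T -> W `<=` U -> subring (setsum T U).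
have base W T U : intermediate [set` R] [set: S] W ->
    intermediate [set` R] [set: S] T -> intermediate [set` R] [set: S] U ->
    minimal_ext W T -> minimal_ext W U -> T <> U -> subring (setsum T U).
  move=> IW IT IU mT mU TU; have [rT RT _] := IT; have [rU RU _] := IU.
  have capW := minimal_ext_cap mT mU TU.
  have rTU := compositum_subring rT rU.
  have len := len2 _ _ _ IW IT IU mT mU TU.
  have mUTU : minimal_ext U (compositum T U).
    by rewrite compositumC //; apply: length2_minimal; rewrite // 1?setIC ?capW // compositumC.
  have [x Tx Ux] : exists2 x, T x & ~ U x.
    apply: contrapT => nx; have [_ _ + _] := (minimal_extE _ _).1 mT.
    move=> /proper_neq; apply; rewrite -capW; apply: setIidl => x Tx.
    by apply: contrapT => Ux; apply: nx; exists x.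
  suff -> : setsum T U = compositum T U by [].
  apply/seteqP; split.
    exact: setsum_sub rTU (compositum_subl rT rU) (compositum_subr rT rU).
  move=> b TUb; have TUx := compositum_subl rT rU Tx.
  (* The compositum is [U + R x], and [R x] lies in [T] by the choice of [x]. *)
  have [u [r [Uu Rr ->]]] := minimal_generation infraR fcpR IU mUTU TUx Ux TUb.
  exists (r * x); first by apply: subringM => //; exact: RT.
  by exists u; rewrite // addrC.
have goodP W : intermediate [set` R] [set: S] W -> good W.
  move=> IW; apply: contrapT => nW.
  (* A maximal counterexample [X]: every minimal extension of [X] is then good. *)
  have [||X [[IX nX] Xmax]] := fcp_max
    (P := fun W => intermediate [set` R] [set: S] W /\ ~ good W) fcpR.
  - by move=> X [].
  - by exists W.
  apply: nX => T U IT IU XT XU; have [rX _ _] := IX.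
  have [rT RT _] := IT; have [rU RU _] := IU.
  have [eT|neT] := pselect (X = T); first by rewrite setsum_absorb // -eT.
  have [eU|neU] := pselect (X = U).
    by rewrite setsumC setsum_absorb // -eU.
  have larger Y : intermediate [set` R] [set: S] Y -> minimal_ext X Y -> good Y.
    move=> IY /minimal_extE [_ _ XY _]; apply: contrapT => nY.
    by case: (proper_neq XY); rewrite (Xmax Y) //; exact: XY.1.
  have [T1 [IT1 mT1 T1T]] := exists_minimal_ext fcpR IX IT (sub_neq_proper XT neT).
  have [U1 [IU1 mU1 U1U]] := exists_minimal_ext fcpR IX IU (sub_neq_proper XU neU).
  have [e1|ne1] := pselect (T1 = U1).
    by apply: (larger T1 IT1 mT1) => //; rewrite e1.
  have [rT1 RT1 _] := IT1; have [rU1 RU1 _] := IU1.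
  have rV := base _ _ _ IX IT1 IU1 mT1 mU1 ne1.
  have IV : intermediate [set` R] [set: S] (setsum T1 U1).
    by split=> //; apply: subset_trans RT1 _; exact: setsum_subl.
  (* [T + U1] equals [T + (T1 + U1)], a sum of two rings above [T1]. *)
  have rZ : subring (setsum T U1).
    have := larger T1 IT1 mT1 _ _ IT IV T1T (@setsum_subl _ _ _ rU1).
    by rewrite setsumA (setsumC T T1) (setsum_absorb rT1 rT).
  have IZ : intermediate [set` R] [set: S] (setsum T U1).
    by split=> //; apply: subset_trans RT _; exact: setsum_subl.
  (* [T + U] equals [(T + U1) + U], a sum of two rings above [U1]. *)
  have := larger U1 IU1 mU1 _ _ IZ IU (@setsum_subr _ _ _ rT) U1U.
  by rewrite -setsumA (setsum_absorb rU1 rU).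
move=> T U IT IU; have [rT RT _] := IT; have [rU RU _] := IU.
split=> //; last by apply: subset_trans RT _; exact: setsum_subl.
by apply: (goodP [set` R]) => //; split.
Qed.

End Conditions.

Unset Implicit Arguments.
Local Open Scope ereal_scope.

Theorem theorem4p18 (S : comNzRingType) (R : subringClosed S) :
  [set` R] `<` [set: S] ->
  infra_integral R ->
  fcp [set` R] [set: S] ->
  [<-> delta_ext [set` R] [set: S];
       modular_ext [set` R] [set: S];
       forall T U : set S,
         intermediate [set` R] [set: S] T ->
         intermediate [set` R] [set: S] U ->
         ext_length (T `&` U) T + ext_length (T `&` U) U =
         ext_length (T `&` U) (compositum T U);
       semimodular_ext [set` R] [set: S];
       forall T U V : set S,
         intermediate [set` R] [set: S] T ->
         intermediate [set` R] [set: S] U ->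
         intermediate [set` R] [set: S] V ->
         minimal_ext T U -> minimal_ext T V -> U <> V ->
         ext_length T (compositum U V) = 2%:E].
Proof.
move=> _ infraR fcpR; have rS : subring [set: S] by apply/subringE.
tfae.
- exact: delta_modular.
- by move=> modRS T U; exact: modular_length.
- exact: additive_semimodular.
- exact: semimodular_minimal_pairs.
- exact: minimal_pairs_delta.
Qed.
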